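(* Let $A,B,C,D,E,F$ be six points in $\mathbb R^4$ such that all six 4-simplices with vertices among them are nondegenerate. Let $\omega_{ABC}$ and $\omega_{DEF}$ be the deficit angles defined in the context, regarded as functions of the fifteen formally independent squared distances between the six points, in a neighbourhood of the values given by the configuration in $\mathbb R^4$ (where $\omega_{ABC}=\omega_{DEF}=0 \pmod{2\pi}$). Then, at that configuration, the differentials of these functions satisfy $$ V_{\hat D}\,V_{-\hat E}\,V_{\hat F}\;\frac{d\omega_{ABC}}{S_{ABC}}\;=\;V_{\hat A}\,V_{-\hat B}\,V_{\hat C}\;\frac{d\omega_{DEF}}{S_{DEF}} . $$
   Context: $\hat A,\hat B,\dots,\hat F$ denote the sequence $ABCDEF$ with the letter $A,B,\dots,F$ removed; e.g. $\hat D=ABCEF$. Such a sequence is an oriented 4-simplex, and $-\hat E$ is $\hat E$ with opposite orientation (e.g. $ABCFD=-\hat E$). $V_{\ldots}$ denotes oriented four-dimensional volume with respect to a fixed orientation of $\mathbb R^4$, so $V_{-\hat E}=-V_{\hat E}$ and $V_{-\hat B}=-V_{\hat B}$. $S_{ABC}$, $S_{DEF}$ are triangle areas. Volumes and areas are evaluated at the given configuration. The dihedral angle of an oriented 4-simplex at a two-dimensional face (between the two three-dimensional faces meeting there) is the inner Euclidean dihedral angle taken with the sign of the oriented volume of the simplex: it lies in $(0,\pi)$ for positive volume and in $(-\pi,0)$ for negative volume. $\omega_{ABC}$ is minus the sum of the dihedral angles at face $ABC$ in the three oriented 4-simplices $\hat D=ABCEF$, $-\hat E=ABCFD$ and $\hat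 F=ABCDE$. $\omega_{DEF}$ is minus the sum of the dihedral angles at face $DEF$ in the three oriented 4-simplices $\hat A$, $-\hat B$ and $\hat C$. Each dihedral angle is calculated separately from the ten squared edge lengths of its own 4-simplex (with the sign of that 4-simplex fixed from the configuration in $\mathbb R^4$), so $\omega_{ABC}$ and $\omega_{DEF}$ are functions of formally independent squared lengths near the given configuration. *)

(* Defs.v *)
From HB Require Import structures.
From mathcomp Require Import all_boot all_order all_algebra.
From mathcomp Require Import all_classical all_reals all_analysis.

Set Implicit Arguments.
Unset Strict Implicit.
Unset Printing Implicit Defensive.

Import Order.TTheory GRing.Theory Num.Theory.
Import numFieldNormedType.Exports.

Local Open Scope classical_set_scope.
Local Open Scope ring_scope.

Section EuclideanFourSpace.
Variable R : realType.

(* The norm that the library puts on 'rV[R]_n is the sup norm, so the Euclidean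
   structure of R^4 is spelled out here. *)
Definition dot (u v : 'rV[R]_4) : R := (u *m v^T) 0 0.

Definition sqdist (p q : 'rV[R]_4) : R := dot (p - q) (p - q).

Definition area (p q r : 'rV[R]_4) : R :=
  Num.sqrt (dot (q - p) (q - p) * dot (r - p) (r - p) - dot (q - p) (r - p) ^+ 2)
  / 2.

(* Oriented volume, for the standard orientation of R^4. *)
Definition vol (Q : 'I_5 -> 'rV[R]_4) : R :=
  \det (\matrix_(i < 4) (Q (lift ord0 i) - Q ord0)) / 4`!%:R.

(* Component of v orthogonal to the rows of M, when these are linearly
   independent. *)
Definition perp_comp (M : 'M[R]_(2, 4)) (v : 'rV[R]_4) : 'rV[R]_4 :=
  v - v *m M^T *m invmx (M *m M^T) *m M.

(* Unoriented angle between nonzero vectors, in [0, pi]. *)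
Definition angle (u v : 'rV[R]_4) : R :=
  acos (dot u v / (Num.sqrt (dot u u) * Num.sqrt (dot v v))).

(* Inner dihedral angle of the 4-simplex Q at the face Q 0, Q 1, Q 2: the angle
   between the directions, orthogonal to that face, that point into the facets
   obtained by adding Q 3 and Q 4 respectively. *)
Definition dihedral (Q : 'I_5 -> 'rV[R]_4) : R :=
  let M : 'M[R]_(2, 4) := \matrix_(i < 2) (Q (inord i.+1) - Q ord0) in
  angle (perp_comp M (Q (inord 3) - Q ord0)) (perp_comp M (Q (inord 4) - Q ord0)).

End EuclideanFourSpace.

Definition vA : 'I_6 := @Ordinal 6 0 isT.
Definition vB : 'I_6 := @Ordinal 6 1 isT.
Definition vC : 'I_6 := @Ordinal 6 2 isT.
Definition vD : 'I_6 := @Ordinal 6 3 isT.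
Definition vE : 'I_6 := @Ordinal 6 4 isT.
Definition vF : 'I_6 := @Ordinal 6 5 isT.

(* The fifteen pairs of vertices, which index the coordinates of the space
   'rV[R]_15 of formally independent squared lengths. *)
Definition edges : 15.-tuple ('I_6 * 'I_6) :=
  [tuple (vA, vB); (vA, vC); (vA, vD); (vA, vE); (vA, vF);
         (vB, vC); (vB, vD); (vB, vE); (vB, vF);
         (vC, vD); (vC, vE); (vC, vF);
         (vD, vE); (vD, vF); (vE, vF)].

Definition simplex (a b c d e : 'I_6) : 'I_5 -> 'I_6 :=
  tnth [tuple a; b; c; d; e].

Section DeficitAngles.
Variable R : realType.

Definition sqlengths (P : 'I_6 -> 'rV[R]_4) : 'rV[R]_15 :=
  \row_(k < 15) sqdist (P (tnth edges k).1) (P (tnth edges k).2).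

(* V P i is the oriented volume of the sequence ABCDEF with the i-th letter
   removed: lift i is the increasing enumeration of the other labels. *)
Definition V (P : 'I_6 -> 'rV[R]_4) (i : 'I_6) : R := vol (P \o lift i).

(* Q is a nondegenerate 4-simplex in R^4 whose ten squared edge lengths are the
   coordinates of l at the edges of s. Each unordered pair occurs once in edges,
   so exactly one of (i, j) and (j, i) triggers the equation. *)
Definition realizes (l : 'rV[R]_15) (s : 'I_5 -> 'I_6)
    (Q : 'I_5 -> 'rV[R]_4) : Prop :=
  vol Q != 0 /\
  forall (i j : 'I_5) (k : 'I_15),
    tnth edges k = (s i, s j) -> sqdist (Q i) (Q j) = l 0 k.

(* Inner dihedral angle at the face s 0, s 1, s 2, as a function of the lengths.
   Realizations are unique up to isometry, so the set has at most one element;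
   it is nonempty as soon as l is close to the lengths of a nondegenerate
   configuration. *)
Definition inner_angle (s : 'I_5 -> 'I_6) (l : 'rV[R]_15) : R :=
  xget 0 [set dihedral Q | Q in [set Q | realizes l s Q]].

(* The sign is that of the oriented simplex in the fixed configuration P; it does
   not depend on l. *)
Definition signed_angle (P : 'I_6 -> 'rV[R]_4) (s : 'I_5 -> 'I_6)
    (l : 'rV[R]_15) : R :=
  Num.sg (vol (P \o s)) * inner_angle s l.

Definition omegaABC (P : 'I_6 -> 'rV[R]_4) (l : 'rV[R]_15) : R :=
  - (signed_angle P (simplex vA vB vC vE vF) l
   + signed_angle P (simplex vA vB vC vF vD) l
   + signed_angle P (simplex vA vB vC vD vE) l).

(* DEFBC, DEFCA and DEFAB are even rearrangements of BCDEF, CADEF and ABDEF, the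
   first and third being ABCDEF without A and without C, and CADEF being
   opposite to ACDEF. *)
Definition omegaDEF (P : 'I_6 -> 'rV[R]_4) (l : 'rV[R]_15) : R :=
  - (signed_angle P (simplex vD vE vF vB vC) l
   + signed_angle P (simplex vD vE vF vC vA) l
   + signed_angle P (simplex vD vE vF vA vB) l).

End DeficitAngles.

(* Main.v *)
(* Both differentials are read off from the stresses they define.  Moving the
   points in R^4 keeps the three dihedral angles around ABC summing to a multiple
   of 2 pi, so the differential of each deficit angle vanishes on the tangent space
   of the realizable squared lengths.  A linear form on the fifteen squared lengths
   with this property is an equilibrium stress on the complete graph; as six
   points in general position in R^4 have a single affine dependence
   lam_i = (-1)^i V_i, the coefficient of the edge ij must be c lam_i lam_j.  The
   constant c is found by varying a single edge, EF for ABC and BC for DEF, on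
   which only one of the three angles depends: the derivative of the dihedral
   angle at ABC of ABCEF with respect to the squared length of EF is
   S_ABC / (24 |V|).  Both sides of the theorem turn out to be
   - (1/24) sum_(i<j) lam_i lam_j h_ij. *)

Require Import Defs.
From HB Require Import structures.
From mathcomp Require Import all_boot all_order all_algebra.
From mathcomp Require Import all_classical all_reals all_analysis.
From mathcomp Require Import perm ring lra zify.

Set Implicit Arguments.
Unset Strict Implicit.
Unset Printing Implicit Defensive.

Import Order.TTheory GRing.Theory Num.Theory.
Import numFieldNormedType.Exports.

Local Open Scope classical_set_scope.
Local Open Scope ring_scope.

(** * Gram determinants *)

Lemma det_fun2 (R : comPzRingType) (f : nat -> nat -> R) :
  \det (\matrix_(i < 2, j < 2) f i j) = f 0 0 * f 1 1 - f 0 1 * f 1 0.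
Proof.
rewrite (expand_det_row _ ord0) !big_ord_recl big_ord0 /cofactor !det_mx11 !mxE /=.
by rewrite /bump /=; ring.
Qed.

Lemma det_funS (R : comPzRingType) n (f : nat -> nat -> R) :
  \det (\matrix_(i < n.+1, j < n.+1) f i j)
  = \sum_(k < n.+1) f 0 k * ((-1) ^+ k
      * \det (\matrix_(i < n, j < n) f i.+1 (bump k j))).
Proof.
rewrite (expand_det_row _ ord0); apply: eq_bigr => k _.
rewrite /cofactor add0n mxE; congr (_ * (_ * \det _)).
by apply/matrixP => i j; rewrite !mxE.
Qed.

(** Laplace expansion along the first two rows, chosen because the six minors of these rows are what
    [gram2_gt0] needs. *)
Lemma det_fun4 (R : comPzRingType) (f : nat -> nat -> R) :
  \det (\matrix_(i < 4, j < 4) f i j) =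
    (f 0 0 * f 1 1 - f 0 1 * f 1 0) * (f 2 2 * f 3 3 - f 2 3 * f 3 2)
  - (f 0 0 * f 1 2 - f 0 2 * f 1 0) * (f 2 1 * f 3 3 - f 2 3 * f 3 1)
  + (f 0 0 * f 1 3 - f 0 3 * f 1 0) * (f 2 1 * f 3 2 - f 2 2 * f 3 1)
  + (f 0 1 * f 1 2 - f 0 2 * f 1 1) * (f 2 0 * f 3 3 - f 2 3 * f 3 0)
  - (f 0 1 * f 1 3 - f 0 3 * f 1 1) * (f 2 0 * f 3 2 - f 2 2 * f 3 0)
  + (f 0 2 * f 1 3 - f 0 3 * f 1 2) * (f 2 0 * f 3 1 - f 2 1 * f 3 0).
Proof.
rewrite det_funS !big_ord_recl big_ord0.
rewrite !(@det_funS R 2 (fun i j => f i.+1 (bump _ j))).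
rewrite !big_ord_recl !big_ord0.
rewrite !(det_fun2 (fun i j => f i.+2 (bump _ (bump _ j)))).
by rewrite /bump /=; ring.
Qed.

Section Gram.
Variable R : realType.
Implicit Types u v w x y b c : 'rV[R]_4.

Lemma dotE u v : dot u v = \sum_(k < 4) u 0 k * v 0 k.
Proof. by rewrite /dot mxE; apply: eq_bigr => k _; rewrite mxE. Qed.

Lemma dotC u v : dot u v = dot v u.
Proof. by rewrite !dotE; apply: eq_bigr => k _; rewrite mulrC. Qed.

Lemma dotDl u v w : dot (u + v) w = dot u w + dot v w.
Proof. by rewrite /dot mulmxDl mxE. Qed.

Lemma dotZl (k : R) u v : dot (k *: u) v = k * dot u v.
Proof. by rewrite /dot -scalemxAl mxE. Qed.

Lemma dotNl u v : dot (- u) v = - dot u v.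
Proof. by rewrite /dot mulNmx mxE. Qed.

Lemma dotDr u v w : dot w (u + v) = dot w u + dot w v.
Proof. by rewrite !(dotC w) dotDl. Qed.

Lemma dotZr (k : R) u v : dot v (k *: u) = k * dot v u.
Proof. by rewrite !(dotC v) dotZl. Qed.

Lemma dotNr u v : dot v (- u) = - dot v u.
Proof. by rewrite !(dotC v) dotNl. Qed.

Definition dot_linE := (dotDl, dotDr, dotNl, dotNr, dotZl, dotZr).

Lemma dot_ge0 u : 0 <= dot u u.
Proof. by rewrite dotE; apply: sumr_ge0 => k _; rewrite -expr2 sqr_ge0. Qed.

Definition rows4 u v w x : 'M[R]_4 := \matrix_(i < 4) tnth [tuple u; v; w; x] i.

Lemma rows4_mulT u v w x u' v' w' x' :
  rows4 u v w x *m (rows4 u' v' w' x')^T =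
  \matrix_(i < 4, j < 4)
    dot (nth 0 [:: u; v; w; x] i) (nth 0 [:: u'; v'; w'; x'] j).
Proof.
apply/matrixP => i j; rewrite !mxE dotE; apply: eq_bigr => k _.
by rewrite !mxE !(tnth_nth 0).
Qed.

Definition gram2 b c := dot b b * dot c c - dot b c ^+ 2.

(* Schur complement of the Gram matrix of (b, c) in that of (b, c, x, y), at the
   entry (x, y). *)
Definition schur (bb bc cc bx cx b_y cy xy : R) : R :=
  xy - (cc * bx * b_y - bc * (bx * cy + cx * b_y) + bb * cx * cy)
       / (bb * cc - bc ^+ 2).

Definition perp_dot b c x y :=
  schur (dot b b) (dot b c) (dot c c) (dot b x) (dot c x)
        (dot b y) (dot c y) (dot x y).

Lemma perp_dotC b c x y : perp_dot b c x y = perp_dot b c y x.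
Proof. by rewrite /perp_dot /schur (dotC x y); congr (_ - _ / _); ring. Qed.

(** The product is the determinant of the mixed Gram matrix of the two quadruples. Both start with
    [b], [c], so eliminating that block leaves a 2 by 2 determinant of Schur complements. Products
    of oriented volumes sharing a triangle thus become scalar products in its normal plane. *)
Lemma det_rows4_mul b c x y z w : gram2 b c != 0 ->
  \det (rows4 b c x y) * \det (rows4 b c z w) =
  gram2 b c * (perp_dot b c x z * perp_dot b c y w
               - perp_dot b c x w * perp_dot b c y z).
Proof.
move=> G0; rewrite -[in X in _ * X]det_tr -det_mulmx rows4_mulT.
rewrite (det_fun4 (fun i j => dot (nth 0 [:: b; c; x; y] i)
                                  (nth 0 [:: b; c; z; w] j))) /=.
rewrite /perp_dot /schur -/(gram2 b c) (dotC c b) (dotC x b) (dotC x c)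
  (dotC y b) (dotC y c).
move: G0; rewrite /gram2; move: (dot b b) (dot b c) (dot c c) => B M C G0.
by field.
Qed.

(** By Lagrange's identity [gram2 b c] is the sum of the squares of the six minors of [b], [c].
    These minors are the coefficients in the Laplace expansion of the determinant, so it would
    vanish with them. *)
Lemma gram2_gt0 b c x y : \det (rows4 b c x y) != 0 -> 0 < gram2 b c.
Proof.
pose f (i j : nat) : R := nth 0 [:: b; c; x; y] i 0 (inord j).
have -> : rows4 b c x y = \matrix_(i < 4, j < 4) f i j.
  by apply/matrixP => i j; rewrite !mxE (tnth_nth 0) /f inord_val.
rewrite (det_fun4 f).
have dE u v : dot u v = u 0 (inord 0) * v 0 (inord 0)
   + u 0 (inord 1) * v 0 (inord 1) + u 0 (inord 2) * v 0 (inord 2)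
   + u 0 (inord 3) * v 0 (inord 3).
  rewrite dotE !big_ord_recl big_ord0 addr0 !addrA.
  by do !congr (_ + _); congr (_ * _); congr (_ _ _);
     apply/val_inj; rewrite /= inordK.
have -> : gram2 b c =
    (f 0 0 * f 1 1 - f 0 1 * f 1 0) ^+ 2 + (f 0 0 * f 1 2 - f 0 2 * f 1 0) ^+ 2
  + (f 0 0 * f 1 3 - f 0 3 * f 1 0) ^+ 2 + (f 0 1 * f 1 2 - f 0 2 * f 1 1) ^+ 2
  + (f 0 1 * f 1 3 - f 0 3 * f 1 1) ^+ 2 + (f 0 2 * f 1 3 - f 0 3 * f 1 2) ^+ 2.
  by rewrite /gram2 !dE /f /=; ring.
set m1 := (X in X ^+ 2 + _ + _ + _ + _ + _).
set m2 := (X in _ + X ^+ 2 + _ + _ + _ + _).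
set m3 := (X in _ + _ + X ^+ 2 + _ + _ + _).
set m4 := (X in _ + _ + _ + X ^+ 2 + _ + _).
set m5 := (X in _ + _ + _ + _ + X ^+ 2 + _).
set m6 := (X in _ + _ + _ + _ + _ + X ^+ 2).
apply: contraNT; rewrite -leNgt => le0.
have z : m1 = 0 /\ m2 = 0 /\ m3 = 0 /\ m4 = 0 /\ m5 = 0 /\ m6 = 0.
  by do ![split]; apply/eqP; rewrite -sqrf_eq0 eq_le sqr_ge0 andbT; nra.
case: z => z1 [z2 [z3 [z4 [z5 z6]]]].
rewrite -[X in X == 0]/(m1 * _ - m2 * _ + m3 * _ + m4 * _ - m5 * _ + m6 * _).
by rewrite z1 z2 z3 z4 z5 z6 !mul0r !(subr0, addr0).
Qed.

Lemma dot_perp_comp (M : 'M[R]_(2, 4)) b c x y :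
  gram2 b c != 0 -> row 0 M = b -> row 1 M = c ->
  dot (perp_comp M x) (perp_comp M y) = perp_dot b c x y.
Proof.
move=> G0 Mb Mc.
have dM u i : (u *m M^T) 0 i = dot u (row i M).
  by rewrite dotE mxE; apply: eq_bigr => k _; rewrite !mxE.
have MM : M *m M^T =
    \matrix_(i < 2, j < 2) dot (nth 0 [:: b; c] i) (nth 0 [:: b; c] j).
  apply/matrixP => i j; rewrite [RHS]mxE.
  have -> : (M *m M^T) i j = dot (row i M) (row j M).
    by rewrite dotE mxE; apply: eq_bigr => k _; rewrite !mxE.
  have rM (k : 'I_2) : row k M = nth 0 [:: b; c] k.
    by case: k => [[|[|//]] ?] /=; rewrite -?Mb -?Mc; congr row; apply/val_inj.
  by rewrite !rM.
have MU : M *m M^T \in unitmx.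
  rewrite unitmxE unitfE MM.
  rewrite (det_fun2 (fun i j => dot (nth 0 [:: b; c] i) (nth 0 [:: b; c] j))) /=.
  by rewrite (dotC c b) -expr2.
(* Coordinates of the projection of [u] on the span of [b] and [c], by Cramer's rule for their Gram
   matrix. *)
pose al u := (dot c c * dot b u - dot b c * dot c u) / gram2 b c.
pose be u := (dot b b * dot c u - dot b c * dot b u) / gram2 b c.
have pE u : perp_comp M u = u - al u *: b - be u *: c.
  rewrite /perp_comp.
  pose r : 'rV[R]_2 := \row_(i < 2) (if i == 0 then al u else be u).
  have -> : u *m M^T = r *m (M *m M^T).
    apply/rowP => j; rewrite dM MM !mxE !big_ord_recl big_ord0 !mxE /= addr0.
    case: j => [[|[|//]] ?] /=; rewrite -?Mb -?Mc.
      rewrite (_ : Ordinal _ = 0); last exact/val_inj.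
      rewrite Mb Mc /al /be (dotC c b) (dotC u b).
      by move: G0; rewrite /gram2 => G0; field.
    rewrite (_ : Ordinal _ = 1); last exact/val_inj.
    rewrite Mb Mc /al /be (dotC u c).
    by move: G0; rewrite /gram2 => G0; field.
  rewrite -!mulmxA [X in r *m X]mulmxA [X in r *m X]mulmxA mulmxV // mul1mx.
  rewrite -addrA -opprD; congr (_ - _).
  rewrite mulmx_sum_row !big_ord_recl big_ord0 !mxE /= addr0.
  by rewrite -Mb -Mc; congr (_ *: row _ _ + _ *: row _ _); apply/val_inj.
rewrite !pE !dot_linE /al /be /perp_dot /schur -/(gram2 b c).
rewrite (dotC c b) (dotC x b) (dotC x c).
by move: G0; rewrite /gram2; move: (dot b b) (dot b c) (dot c c) => B m C G0; field.
Qed.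

Lemma perp_dot_ge0 b c x : gram2 b c != 0 -> 0 <= perp_dot b c x x.
Proof.
move=> G0; pose M : 'M[R]_(2, 4) := \matrix_(i < 2) tnth [tuple b; c] i.
by rewrite -(@dot_perp_comp M b c x x G0) ?rowK ?dot_ge0.
Qed.

(** Taking the same quadruple twice in [det_rows4_mul] writes the squared determinant as [gram2 b c]
    times the last quantity; the other two are nonnegative with a positive product. *)
Lemma perp_dot_gt0 b c x y : \det (rows4 b c x y) != 0 ->
  [/\ 0 < perp_dot b c x x, 0 < perp_dot b c y y &
   0 < perp_dot b c x x * perp_dot b c y y - perp_dot b c x y ^+ 2].
Proof.
move=> D0; have G0 := gram2_gt0 D0.
have : 0 < \det (rows4 b c x y) ^+ 2 by rewrite exprn_even_gt0.
rewrite expr2 det_rows4_mul ?gt_eqF // pmulr_rgt0 // (perp_dotC _ _ y x) -expr2 => H.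
have xy0 : 0 < perp_dot b c x x * perp_dot b c y y.
  by rewrite (lt_le_trans H) // gerBl sqr_ge0.
have G0' : gram2 b c != 0 by rewrite gt_eqF.
by split=> //; rewrite lt_def (perp_dot_ge0 _ G0') andbT; apply/eqP => z;
  move: xy0; rewrite z ?mul0r ?mulr0 ltxx.
Qed.

End Gram.

(** * Angles as functions of squared lengths *)

(* Sealed, like len below: unification would otherwise unfold the search. *)
HB.lock Definition edge_index (i j : 'I_6) : 'I_15 :=
  inord (find (pred2 (i, j) (j, i)) edges).

Lemma edge_indexC (i j : 'I_6) : edge_index i j = edge_index j i.
Proof. by rewrite edge_index.unlock; congr inord; apply: eq_find => e /=; rewrite orbC. Qed.

Lemma edge_indexP (i j : 'I_6) : i != j ->
  tnth edges (edge_index i j) = (i, j) \/ tnth edges (edge_index i j) = (j, i).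
Proof.
move=> ij.
have H : has (pred2 (i, j) (j, i)) edges.
  by move: ij; case: i => [[|[|[|[|[|[|//]]]]]] ?]; case: j => [[|[|[|[|[|[|//]]]]]] ?].
have := nth_find (vA, vA) H; rewrite (tnth_nth (vA, vA)) edge_index.unlock inordK.
  by move=> /orP [/eqP ->|/eqP ->]; [left|right].
by move: H; rewrite has_find.
Qed.

Lemma edges_neq (k : 'I_15) : (tnth edges k).1 != (tnth edges k).2.
Proof. by case: k; do 15?[case=> //]. Qed.

Lemma edge_index_edges (k : 'I_15) :
  edge_index (tnth edges k).1 (tnth edges k).2 = k.
Proof.
apply/val_inj; rewrite edge_index.unlock.
case: k; do 15?[case=> [?|]; first by rewrite /= inordK].
by [].
Qed.

HB.lock Definition len (R : realType) (l : 'rV[R]_15) (i j : 'I_6) : R :=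
  if i == j then 0 else l 0 (edge_index i j).

Section Lengths.
Variable R : realType.
Implicit Types (l : 'rV[R]_15) (a b c x y i j : 'I_6).

Lemma lenE l i j : len l i j = if i == j then 0 else l 0 (edge_index i j).
Proof. by rewrite len.unlock. Qed.

Lemma lenC l i j : len l i j = len l j i.
Proof. by rewrite !lenE eq_sym edge_indexC. Qed.

Lemma lenxx l i : len l i i = 0. Proof. by rewrite lenE eqxx. Qed.

Lemma len_edges l (k : 'I_15) : len l (tnth edges k).1 (tnth edges k).2 = l 0 k.
Proof. by rewrite lenE (negPf (edges_neq k)) edge_index_edges. Qed.

Lemma sqdistC (p q : 'rV[R]_4) : sqdist p q = sqdist q p.
Proof. by rewrite /sqdist -opprB dotNl dotNr opprK. Qed.

Lemma sqdistxx (p : 'rV[R]_4) : sqdist p p = 0.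
Proof. by rewrite /sqdist subrr /dot mul0mx mxE. Qed.

Lemma len_sqlengths (P : 'I_6 -> 'rV[R]_4) i j :
  len (sqlengths P) i j = sqdist (P i) (P j).
Proof.
rewrite lenE; case: eqVneq => [->|ij]; first by rewrite sqdistxx.
by rewrite mxE; case: (edge_indexP ij) => -> //=; rewrite sqdistC.
Qed.

(** Polarization: the scalar product of the edge vectors from [a] to [i] and to [j], meaningful also
    for lengths that no points of R^4 realize. *)
Definition len_dot l a (i j : 'I_6) := (len l a i + len l a j - len l i j) / 2.

Lemma len_dotC l a (i j : 'I_6) : len_dot l a i j = len_dot l a j i.
Proof. by rewrite /len_dot (lenC l i j) (addrC (len l a i)). Qed.

Lemma dot_sqdist (p q r : 'rV[R]_4) :
  dot (q - p) (r - p) = (sqdist p q + sqdist p r - sqdist q r) / 2.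
Proof.
rewrite /sqdist !dot_linE (dotC q p) (dotC r p) (dotC r q).
by apply: (@mulIf _ 2) => //; field.
Qed.

Lemma len_dot_sqlengths (P : 'I_6 -> 'rV[R]_4) a i j :
  len_dot (sqlengths P) a i j = dot (P i - P a) (P j - P a).
Proof. by rewrite /len_dot !len_sqlengths dot_sqdist. Qed.

Definition len_perp_dot l a b c x y :=
  schur (len_dot l a b b) (len_dot l a b c) (len_dot l a c c)
        (len_dot l a b x) (len_dot l a c x)
        (len_dot l a b y) (len_dot l a c y) (len_dot l a x y).

Lemma len_perp_dot_sqlengths (P : 'I_6 -> 'rV[R]_4) a b c x y :
  len_perp_dot (sqlengths P) a b c x y =
  perp_dot (P b - P a) (P c - P a) (P x - P a) (P y - P a).
Proof. by rewrite /len_perp_dot !len_dot_sqlengths. Qed.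

(** Closed formula for the inner dihedral angle, to be differentiated in place of the choice of a
    realization in [inner_angle]. *)
Definition len_angle a b c x y l :=
  acos (len_perp_dot l a b c x y /
    (Num.sqrt (len_perp_dot l a b c x x) * Num.sqrt (len_perp_dot l a b c y y))).

Definition vol_form (a b c x y : 'rV[R]_4) :=
  \det (rows4 (b - a) (c - a) (x - a) (y - a)).

Lemma vol_formE (Q : 'I_5 -> 'rV[R]_4) :
  vol Q = vol_form (Q (inord 0)) (Q (inord 1)) (Q (inord 2)) (Q (inord 3))
                   (Q (inord 4)) / 4`!%:R.
Proof.
congr (\det _ / _); apply/row_matrixP => i; rewrite !rowK.
have -> : ord0 = inord 0 :> 'I_5 by apply/val_inj; rewrite /= inordK.
case: i => [[|[|[|[|//]]]] Hi]; rewrite (tnth_nth 0) /=;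
  by congr (Q _ - _); apply/val_inj; rewrite /= !inordK.
Qed.

Lemma fact4_neq0 : 4`!%:R != 0 :> R.
Proof. by rewrite pnatr_eq0. Qed.

Lemma vol_simplex (P : 'I_6 -> 'rV[R]_4) a b c x y :
  vol (P \o simplex a b c x y) = vol_form (P a) (P b) (P c) (P x) (P y) / 4`!%:R.
Proof. by rewrite vol_formE /= /simplex !(tnth_nth a) !inordK. Qed.

Lemma vol_simplex_eq0 (P : 'I_6 -> 'rV[R]_4) a b c x y :
  (vol (P \o simplex a b c x y) == 0) = (vol_form (P a) (P b) (P c) (P x) (P y) == 0).
Proof. by rewrite vol_simplex mulf_eq0 invr_eq0 (negPf fact4_neq0) orbF. Qed.

Lemma realizes_sqdist l (s : 'I_5 -> 'I_6) Q (i j : 'I_5) : injective s ->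
  realizes l s Q -> sqdist (Q i) (Q j) = len l (s i) (s j).
Proof.
move=> s_inj [_ Ql]; case: (eqVneq i j) => [->|ij]; first by rewrite lenxx sqdistxx.
have sij : s i != s j by apply: contra ij => /eqP /s_inj ->.
rewrite lenE (negPf sij).
case: (edge_indexP sij) => /Ql <- //; exact: sqdistC.
Qed.

(** The dihedral angle depends only on scalar products of edge vectors at the first vertex, which
    the lengths determine. Hence all realizations give the same angle. *)
Lemma dihedral_realizes l a b c x y Q : uniq [:: a; b; c; x; y] ->
  realizes l (simplex a b c x y) Q -> dihedral Q = len_angle a b c x y l.
Proof.
move=> U Ql; have s_inj : injective (simplex a b c x y) by apply/tuple_uniqP.
have dotQ (i j : 'I_5) : dot (Q i - Q ord0) (Q j - Q ord0) =
    len_dot l a (simplex a b c x y i) (simplex a b c x y j).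
  by rewrite dot_sqdist !(realizes_sqdist _ _ s_inj Ql).
have sE k : (k < 5)%N -> simplex a b c x y (inord k) = nth a [:: a; b; c; x; y] k.
  by move=> k5; rewrite /simplex (tnth_nth a) inordK.
have E0 : inord 0 = ord0 :> 'I_5 by apply/val_inj; rewrite /= inordK.
have G0 : gram2 (Q (inord 1) - Q ord0) (Q (inord 2) - Q ord0) != 0.
  case: Ql => + _; rewrite vol_formE mulf_eq0 negb_or /vol_form E0 => /andP[V0 _].
  by rewrite gt_eqF // (gram2_gt0 V0).
rewrite /dihedral /angle /=; set M := \matrix_i _.
have M0 : row 0 M = Q (inord 1) - Q ord0 by rewrite rowK.
have M1 : row 1 M = Q (inord 2) - Q ord0 by rewrite rowK.
rewrite !(dot_perp_comp _ _ G0 M0 M1) /perp_dot !dotQ !sE //=.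
Qed.

End Lengths.

(** * Realizing nearby squared lengths *)

Section Realization.
Variable R : realType.
Implicit Types (l : 'rV[R]_15) (a b c x y : 'I_6).

(** Cholesky elimination by induction on the size: close to the identity the pivot is positive, and
    the Schur complement is again close to the identity. *)
Lemma cholesky_near_id n : exists2 e : R, 0 < e &
  forall H : 'M[R]_n, H^T = H -> (forall i j, `|H i j - (i == j)%:R| <= e) ->
  exists2 L, L \in unitmx & L *m L^T = H.
Proof.
elim: n => [|n [e e0 IH]].
  exists 1 => // H _ _; exists 1%:M; first exact: unitmx1.
  by apply/matrixP => -[].
(* The bound 1/2 keeps the pivot at least 1/2, so the correction [v i * v j / a] is at most [d]; the
   bound [e / 2] then keeps the Schur complement within [d + d <= e] of the identity. *)
pose d := Num.min (1 / 2) (e / 2).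
have d0 : 0 < d by rewrite /d lt_min; apply/andP; split; lra.
have d1 : d <= 1 / 2 by rewrite /d ge_min lexx.
have de : d <= e / 2 by rewrite /d ge_min lexx orbT.
exists d => // H; rewrite -[n.+1]/(1 + n)%N in H *.
rewrite -[H]submxK.
move: (ulsubmx H) (ursubmx H) (dlsubmx H) (drsubmx H) => a v w B.
rewrite tr_block_mx => /eq_block_mx [_ vw wv BT] Hd.
have aE : a = (a 0 0)%:M by rewrite -mx11_scalar.
have da : `|a 0 0 - 1| <= d.
  by have := Hd (lshift n 0) (lshift n 0); rewrite block_mxEul eqxx.
have dv j : `|v 0 j| <= d.
  have := Hd (lshift n 0) (rshift 1 j).
  by rewrite block_mxEur eq_lrshift subr0.
have dB i j : `|B i j - (i == j)%:R| <= d.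
  by have := Hd (rshift 1 i) (rshift 1 j); rewrite block_mxEdr eq_rshift.
have a12 : 1 / 2 <= a 0 0 by move: da; rewrite ler_norml => /andP[]; lra.
have a0 : 0 < a 0 0 by lra.
have sa0 : 0 < Num.sqrt (a 0 0) by rewrite sqrtr_gt0.
have [||L LU LE] := IH (B - (a 0 0)^-1 *: (v^T *m v)).
- by rewrite linearB linearZ /= trmx_mul trmxK BT.
- move=> i j; rewrite !mxE big_ord1 mxE addrAC.
  apply: (le_trans (ler_normB _ _)); rewrite !normrM normfV (gtr0_norm a0).
  have : (a 0 0)^-1 * (`|v 0 i| * `|v 0 j|) <= d.
    rewrite ler_pdivrMl //; apply: (@le_trans _ _ (d * d)); first exact: ler_pM.
    by rewrite ler_pM2r //; lra.
  by have := dB i j; lra.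
exists (block_mx (Num.sqrt (a 0 0))%:M 0 ((Num.sqrt (a 0 0))^-1 *: v^T) L).
  by rewrite unitmxE det_lblock det_scalar1 unitrM -unitmxE LU andbT unitfE gt_eqF.
rewrite tr_block_mx mulmx_block tr_scalar_mx !linearZ /= trmxK trmx0.
rewrite !mul0mx !mulmx0 !addr0 -!scalar_mxM mul_scalar_mx -scalemxAl mul_mx_scalar.
rewrite -scalemxAl !scalerA LE.
rewrite -invfM -!expr2 sqr_sqrtr ?ltW // !mulVf ?gt_eqF // !scale1r.
by rewrite -aE -vw trmxK addrC subrK.
Qed.

Lemma differentiable_len (i j : 'I_6) l : differentiable (fun l => len l i j) l.
Proof.
rewrite len.unlock; case: eqVneq => _; first exact: differentiable_cst.
exact: differentiable_coord.
Qed.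

Lemma differentiable_len_dot a (i j : 'I_6) l :
  differentiable (fun l => len_dot l a i j) l.
Proof.
apply: differentiableM => //; apply: differentiableB; last exact: differentiable_len.
by apply: differentiableD; exact: differentiable_len.
Qed.

(** Relative to the edge frame [M] of the given simplex, the Gram matrix [K l] prescribed by the
    lengths becomes [H l], which is the identity at the configuration. A Cholesky factor [L] of
    [H l] yields the edge vectors [M *m L]; the first vertex is put at the origin. *)
Lemma near_realizes (P : 'I_6 -> 'rV[R]_4) a b c x y :
  vol_form (P a) (P b) (P c) (P x) (P y) != 0 ->
  \forall l \near sqlengths P, exists Q, realizes l (simplex a b c x y) Q.
Proof.
rewrite /vol_form; set M := rows4 _ _ _ _ => M0.
have MU : M \in unitmx by rewrite unitmxE unitfE.
pose t (i : 'I_4) := simplex a b c x y (lift ord0 i).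
pose K l : 'M[R]_4 := \matrix_(i, j) len_dot l a (t i) (t j).
have KT l : (K l)^T = K l.
  by apply/matrixP => i j; rewrite mxE [LHS]mxE [RHS]mxE len_dotC.
pose H l := invmx M *m K l *m (invmx M)^T.
have K0 : K (sqlengths P) = M *m M^T.
  rewrite rows4_mulT; apply/matrixP => i j; rewrite !mxE len_dot_sqlengths.
  by case: i => [[|[|[|[|//]]]] ?]; case: j => [[|[|[|[|//]]]] ?].
have H0 : H (sqlengths P) = 1%:M.
  by rewrite /H K0 mulmxA mulVmx // mul1mx -trmx_mul mulVmx // trmx1.
have Hc i j : {for sqlengths P, continuous (fun l => H l i j)}.
  apply: differentiable_continuous.
  have -> : (fun l => H l i j) = \sum_k (fun l =>
      (\sum_k' (fun l => invmx M i k' * len_dot l a (t k') (t k))) l * invmx M j k).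
    apply/funext => l; rewrite /H mxE fct_sumE; apply: eq_bigr => k _.
    by rewrite !mxE fct_sumE; congr (_ * _); apply: eq_bigr => k' _; rewrite mxE.
  apply: differentiable_sum => k; apply: differentiableM => //.
  apply: differentiable_sum => k'; apply: differentiableM => //.
  exact: differentiable_len_dot.
have [e e0 He] := cholesky_near_id 4.
have : \forall l \near sqlengths P, forall i j, `|H l i j - (i == j)%:R| <= e.
  have FF := nbhs_filter (sqlengths P).
  apply: (filter_forall FF) => i; apply: (filter_forall FF) => j.
  have /cvgr_distC_le/(_ _ e0) := Hc i j.
  by rewrite H0 mxE.
apply: filterS => l Hl.
have [|L LU LE] := He (H l) _ Hl.
  by rewrite /H !trmx_mul trmxK KT mulmxA.
pose N := M *m L.
have NE : N *m N^T = K l.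
  rewrite /N trmx_mul -mulmxA (mulmxA L) LE /H -!mulmxA (mulmxA M) mulmxV // mul1mx.
  by rewrite -trmx_mul mulmxV // trmx1 mulmx1.
pose Q (i : 'I_5) : 'rV_4 := if unlift ord0 i is Some k then row k N else 0.
have Q0 : Q ord0 = 0 by rewrite /Q unlift_none.
have QS i : Q (lift ord0 i) = row i N by rewrite /Q liftK.
have dotQ i j : dot (Q i) (Q j) =
    len_dot l a (simplex a b c x y i) (simplex a b c x y j).
  have s0 : simplex a b c x y ord0 = a by [].
  have dot0r u : dot u 0 = 0 :> R by rewrite /dot trmx0 mulmx0 mxE.
  case: (unliftP ord0 i) => [i' ->|->]; last first.
    by rewrite Q0 s0 dotC dot0r /len_dot lenxx add0r subrr mul0r.
  case: (unliftP ord0 j) => [j' ->|->]; last first.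
    by rewrite Q0 s0 dot0r /len_dot (lenC l _ a) lenxx addr0 subrr mul0r.
  have := congr1 (fun A : 'M[R]_4 => A i' j') NE; rewrite !QS [in RHS]mxE => <-.
  by rewrite dotE mxE; apply: eq_bigr => k _; rewrite !mxE.
exists Q; split.
  rewrite /vol (_ : \matrix_i _ = N); last first.
    by apply/row_matrixP => i; rewrite rowK QS Q0 subr0.
  by rewrite mulf_neq0 ?invr_eq0 ?fact4_neq0 // det_mulmx mulf_neq0 // -unitfE -unitmxE.
move=> i j k kE.
rewrite -len_edges kE /= /sqdist !dot_linE !dotQ (len_dotC _ _ (simplex _ _ _ _ _ j)).
rewrite /len_dot !lenxx.
by field.
Qed.

(** A realization exists nearby, so [xget] does not return its default 0, and any realization it
    picks has the angle given by the formula. *)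
Lemma near_inner_angle (P : 'I_6 -> 'rV[R]_4) a b c x y :
  vol_form (P a) (P b) (P c) (P x) (P y) != 0 -> uniq [:: a; b; c; x; y] ->
  \forall l \near sqlengths P,
    inner_angle (simplex a b c x y) l = len_angle a b c x y l.
Proof.
move=> V0 U; apply: filterS (near_realizes V0) => l [Q Ql]; rewrite /inner_angle.
case: xgetP => [z _ [Q' Q'l <-]|/(_ (dihedral Q)) []]; first exact: dihedral_realizes Q'l.
by exists Q.
Qed.

End Realization.

(** * Differentiability *)

Section NearDifferential.
Variable R : realType.

Lemma differentiable_near0 (V W : normedModType R) (h : V -> W) (x : V) :
  (\forall y \near x, h y = 0) -> differentiable h x /\ 'd h x = 0 :> (V -> W).
Proof.
move=> h0; pose z : {linear V -> W} := \0.
have zc : continuous z by exact: cst_continuous.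
have hE : h \o shift x = cst (h x) + z +o_ 0 id.
  apply/eqaddoP => e e0; have hx : h x = 0 by exact: nbhs_singleton h0.
  have : \forall y \near (0 : V), h (y + x) = 0.
    by move: h0; rewrite (near_shift 0) subr0.
  apply: filterS => y hy.
  by rewrite !fctE /= hy hx addr0 subr0 normr0 mulr_ge0 // ltW.
have dz := diff_unique zc hE; split; last by rewrite dz.
by apply/diff_locallyP; rewrite dz.
Qed.

(** Differentials are local: [g - f] vanishes near [x], so it contributes nothing. This carries
    differentials from [len_angle] to [inner_angle]. *)
Lemma near_eq_differentiable (V W : normedModType R) (f g : V -> W) (x : V) :
  (\forall y \near x, f y = g y) -> differentiable f x ->
  differentiable g x /\ 'd g x = 'd f x :> (V -> W).
Proof.
move=> fg df.
have [|dh h0] := @differentiable_near0 V W (g - f) x.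
  by apply: filterS fg => y e; rewrite !fctE e subrr.
have -> : g = f + (g - f) by rewrite addrC subrK.
split; first exact: differentiableD.
have idf : is_diff x f ('d f x) by split.
have idh : is_diff x (g - f) 0 by split.
have := is_diffD idf idh.
by rewrite addr0 => -[].
Qed.

Lemma derive_line (V W : normedModType R) (f : V -> W) (x v : V) (k : W) :
  differentiable f x -> is_derive (0 : R) 1 (fun t => f (t *: v + x)) k ->
  'd f x v = k.
Proof.
move=> df [_ <-]; rewrite -deriveE // /derive.
set g1 := fun h => h^-1 *: _; set g2 := fun h => h^-1 *: _.
suff -> : g1 = g2 by [].
by rewrite funeqE /g1 /g2 => h /=; rewrite addr0 scale0r add0r [_%:A]mulr1.
Qed.

End NearDifferential.

(** * Differentiability of the dihedral angle in the squared lengths *)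

Section AngleDifferential.
Variable R : realType.
Implicit Types (l : 'rV[R]_15) (a b c x y : 'I_6).

Definition len_gram2 l a b c :=
  len_dot l a b b * len_dot l a c c - len_dot l a b c ^+ 2.

Lemma differentiable_len_perp_dot l a b c x y : len_gram2 l a b c != 0 ->
  differentiable (fun l => len_perp_dot l a b c x y) l.
Proof.
move=> G0; pose d i j l := len_dot l a i j; pose G := d b b * d c c - d b c * d b c.
have D i j : differentiable (d i j) l by exact: differentiable_len_dot.
have -> : (fun l => len_perp_dot l a b c x y) =
    d x y - (d c c * d b x * d b y - d b c * (d b x * d c y + d c x * d b y)
             + d b b * d c x * d c y) * (fun l => (G l : R)^-1).
  by apply/funext => l'.
have DD i j k m : differentiable (d i j * d k m) l by exact: (differentiableM (D _ _) (D _ _)).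
have DDD i j k m n o : differentiable (d i j * d k m * d n o) l.
  exact: (differentiableM (DD _ _ _ _) (D _ _)).
apply: (differentiableB (D _ _)); apply: differentiableM.
  apply: (differentiableD _ (DDD _ _ _ _ _ _)).
  apply: (differentiableB (DDD _ _ _ _ _ _)).
  apply: (differentiableM (D _ _)).
  exact: (differentiableD (DD _ _ _ _) (DD _ _ _ _)).
apply: differentiableV; last exact: G0.
exact: (differentiableB (DD _ _ _ _) (DD _ _ _ _)).
Qed.

(** What makes [len_angle] smooth: a nonzero denominator in the Schur complements, positive
    arguments of the square roots, and strict Cauchy-Schwarz, which keeps the argument of [acos]
    inside (-1, 1). *)
Definition nondeg_len l a b c x y :=
  [/\ len_gram2 l a b c != 0, 0 < len_perp_dot l a b c x x,
      0 < len_perp_dot l a b c y y &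
      0 < len_perp_dot l a b c x x * len_perp_dot l a b c y y
          - len_perp_dot l a b c x y ^+ 2].

Lemma nondeg_len_sqlengths (P : 'I_6 -> 'rV[R]_4) a b c x y :
  vol_form (P a) (P b) (P c) (P x) (P y) != 0 ->
  nondeg_len (sqlengths P) a b c x y.
Proof.
move=> V0; have [X0 Y0 D0] := perp_dot_gt0 V0; have G0 := gram2_gt0 V0.
split; rewrite ?len_perp_dot_sqlengths // /len_gram2 !len_dot_sqlengths.
by rewrite gt_eqF.
Qed.

Lemma cos_quotient_lt1 (p q r : R) : 0 < q -> 0 < r -> 0 < q * r - p ^+ 2 ->
  -1 < p / (Num.sqrt q * Num.sqrt r) < 1.
Proof.
move=> q0 r0 D0; have s0 : 0 < Num.sqrt q * Num.sqrt r by rewrite mulr_gt0 ?sqrtr_gt0.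
rewrite ltr_pdivlMr // ltr_pdivrMr // mulN1r mul1r -ltr_norml.
rewrite -(ltr_pXn2r (n := 2)) ?nnegrE ?normr_ge0 ?(ltW s0) // exprMn.
by rewrite !sqr_sqrtr ?ltW // real_normK ?num_real // -subr_gt0.
Qed.

Lemma differentiable_len_angle l a b c x y : nondeg_len l a b c x y ->
  differentiable (len_angle a b c x y) l.
Proof.
move=> [G0 X0 Y0 D0].
have H := cos_quotient_lt1 X0 Y0 D0.
have sq z : 0 < len_perp_dot l a b c z z ->
    differentiable (fun l => Num.sqrt (len_perp_dot l a b c z z)) l.
  move=> z0; apply: (@differentiable_comp _ _ _ _ (fun l => len_perp_dot l a b c z z) Num.sqrt).
    exact: differentiable_len_perp_dot.
  by apply/derivable1_diffP; have [] := is_derive1_sqrt z0.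
apply: (@differentiable_comp _ _ _ _ (fun l => len_perp_dot l a b c x y /
    (Num.sqrt (len_perp_dot l a b c x x) * Num.sqrt (len_perp_dot l a b c y y))) acos).
  apply: differentiableM; first exact: differentiable_len_perp_dot.
  apply: differentiableV; first by apply: differentiableM; exact: sq.
  by rewrite mulf_neq0 // gt_eqF // sqrtr_gt0.
by apply/derivable1_diffP; have [] := is_derive1_acos H.
Qed.

End AngleDifferential.

(** * Deficit angles of a configuration *)

Section DeficitValue.
Variable R : realType.
Implicit Types (P : 'I_6 -> 'rV[R]_4) (a b c d e f x y : 'I_6).

Lemma cosD_int (m : int) (t : R) : cos (t + m%:~R * (2 * pi)) = cos t.
Proof.
have cosn n u : cos (u + n%:R * (2 * pi)) = cos u :> R.
  by rewrite mulr_natl mulr_natl (periodicn (@cosD2pi R)).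
case: m => n; first exact: cosn.
by rewrite NegzE mulrNz mulNr -[LHS](cosn n.+1) subrK.
Qed.

(** Removing full turns leaves a remainder in [0, 2 pi). Its half lies in [0, pi) and has sine 0 by
    the double angle formula, so it is 0. *)
Lemma cos_eq1 (t : R) : cos t = 1 -> exists m : int, t = m%:~R * (2 * pi).
Proof.
move=> ct; have pi0 := pi_gt0 R; have p0 : 0 < 2 * (pi : R) by lra.
pose m := Num.floor (t / (2 * pi)); exists m.
have /andP[] := Num.Theory.floor_itv (t / (2 * pi)).
rewrite -/m intrD ler_pdivlMr // ltr_pdivrMr // (mulrDl m%:~R) mul1r => lo hi.
pose s := (t - m%:~R * (2 * pi)) / 2.
have : cos (s *+ 2) = 1.
  rewrite (_ : s *+ 2 = t + (- m)%:~R * (2 * pi)) ?cosD_int //.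
  by rewrite /s mulrNz -mulr_natl; field.
rewrite cos_mulr2n cos2sin2 => sin0.
have : sin s ^+ 2 == 0 by apply/eqP; lra.
rewrite sqrf_eq0 => /eqP ss; apply/eqP; rewrite eq_sym; apply: contraT => tm.
have : 0 < sin s; last by rewrite ss ltxx.
have tm' : m%:~R * (2 * pi) < t by rewrite lt_neqAle tm.
by apply: sin_gt0_pi; rewrite /s; apply/andP; split; lra.
Qed.

Lemma sgr_vol P a b c x y :
  Num.sg (vol (P \o simplex a b c x y)) = Num.sg (vol_form (P a) (P b) (P c) (P x) (P y)).
Proof. by rewrite vol_simplex sgrM sgrV (gtr0_sg (x := 4`!%:R)) ?ltr0n // mulr1. Qed.

(** By [det_rows4_mul], [W ^+ 2] is [gram2 b c] times the Gram determinant of the normal components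
    of [x] and [y]. *)
Lemma sin_dihedral (b c x y : 'rV[R]_4) (W := \det (rows4 b c x y))
    (s := Num.sqrt (perp_dot b c x x) * Num.sqrt (perp_dot b c y y)) : W != 0 ->
  Num.sqrt (1 - (perp_dot b c x y / s) ^+ 2) = `|W| / (Num.sqrt (gram2 b c) * s).
Proof.
move=> W0; have [X0 Y0 _] := perp_dot_gt0 W0; have G0 := gram2_gt0 W0.
rewrite /s; set rx := Num.sqrt (perp_dot b c x x); set ry := Num.sqrt (perp_dot b c y y).
have rx0 : 0 < rx by rewrite sqrtr_gt0.
have ry0 : 0 < ry by rewrite sqrtr_gt0.
set g := Num.sqrt (gram2 _ _); have g0 : 0 < g by rewrite sqrtr_gt0.
have -> : 1 - (perp_dot b c x y / (rx * ry)) ^+ 2 = (W / (g * (rx * ry))) ^+ 2.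
  rewrite !expr_div_n !exprMn !sqr_sqrtr ?ltW //.
  rewrite [W ^+ 2]expr2 det_rows4_mul ?gt_eqF // (perp_dotC _ _ y x); field.
  by rewrite !gt_eqF.
by rewrite sqrtr_sqr normrM (gtr0_norm (x := _^-1)) ?invr_gt0 ?mulr_gt0.
Qed.

(** The sign attached to the angle leaves the cosine alone and turns the absolute value in the sine
    into the oriented [W], so the sines can be multiplied by [det_rows4_mul]. *)
Lemma trig_signed_angle P a b c x y (D := fun x y =>
    perp_dot (P b - P a) (P c - P a) (P x - P a) (P y - P a))
    (W := vol_form (P a) (P b) (P c) (P x) (P y))
    (t := signed_angle P (simplex a b c x y) (sqlengths P)) :
  uniq [:: a; b; c; x; y] -> W != 0 ->
  cos t = D x y / (Num.sqrt (D x x) * Num.sqrt (D y y)) /\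
  sin t = W / (Num.sqrt (gram2 (P b - P a) (P c - P a)) *
               (Num.sqrt (D x x) * Num.sqrt (D y y))).
Proof.
move=> U W0; have [X0 Y0 D0] := perp_dot_gt0 W0; have G0 := gram2_gt0 W0.
have H := cos_quotient_lt1 X0 Y0 D0.
rewrite /t /signed_angle sgr_vol -/W.
rewrite (nbhs_singleton (near_inner_angle W0 U)) /len_angle !len_perp_dot_sqlengths.
have H' : -1 <= D x y / (Num.sqrt (D x x) * Num.sqrt (D y y)) <= 1.
  by case/andP: H => /ltW -> /ltW ->.
rewrite cos_sg ?acosK ?in_itv //=.
split=> //; rewrite sin_sg sin_acos //.
by rewrite (sin_dihedral W0) [LHS]mulrA -numEsg.
Qed.

(** Common shape of both deficit angles: [omegaABC] for the order A B C D E F, [omegaDEF] for D E F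
    A B C. *)
Definition deficit P a b c d e f (l : 'rV[R]_15) : R :=
  - (signed_angle P (simplex a b c e f) l + signed_angle P (simplex a b c f d) l
     + signed_angle P (simplex a b c d e) l).

Definition nondeg P a b c d e f : Prop :=
  [/\ uniq [:: a; b; c; d; e; f],
      vol_form (P a) (P b) (P c) (P e) (P f) != 0,
      vol_form (P a) (P b) (P c) (P f) (P d) != 0 &
      vol_form (P a) (P b) (P c) (P d) (P e) != 0].

Lemma uniq_simplices a b c d e f : uniq [:: a; b; c; d; e; f] ->
  [/\ uniq [:: a; b; c; e; f], uniq [:: a; b; c; f; d] & uniq [:: a; b; c; d; e]].
Proof.
rewrite /= !inE !negb_or (eq_sym f d) -!andbA.
by do 14?[case/andP => -> ]; move=> -> /=; split.
Qed.

(* The angle between x and y has cosine Dxy / (rx ry) and sine W1 / (g rx ry), and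
   so on cyclically.  The left hand side, the cosine of the sum of the three angles,
   contains sines only in pairs, and those products are given by det_rows4_mul. *)
Lemma cos_sum_eq1 (g rx ry rz Dxy Dyz Dzx W1 W2 W3 : R) :
  g != 0 -> rx != 0 -> ry != 0 -> rz != 0 ->
  W1 * W2 = g ^+ 2 * (Dxy * Dyz - Dzx * ry ^+ 2) ->
  W1 * W3 = g ^+ 2 * (Dzx * Dxy - rx ^+ 2 * Dyz) ->
  W2 * W3 = g ^+ 2 * (Dyz * Dzx - Dxy * rz ^+ 2) ->
  W1 * W1 = g ^+ 2 * (rx ^+ 2 * ry ^+ 2 - Dxy ^+ 2) ->
  W3 * W3 = g ^+ 2 * (rz ^+ 2 * rx ^+ 2 - Dzx ^+ 2) ->
  (Dxy / (rx * ry) * (Dyz / (ry * rz)) - W1 / (g * (rx * ry)) * (W2 / (g * (ry * rz))))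
    * (Dzx / (rz * rx))
  - (W1 / (g * (rx * ry)) * (Dyz / (ry * rz)) + Dxy / (rx * ry) * (W2 / (g * (ry * rz))))
    * (W3 / (g * (rz * rx))) = 1.
Proof.
move=> g0 x0 y0 z0 e12 e13 e23 e11 e33.
(* Three vectors in the normal plane are dependent, so their 3 by 3 Gram determinant vanishes. *)
have K : Dzx ^+ 2 * ry ^+ 2 + Dyz ^+ 2 * rx ^+ 2 + Dxy ^+ 2 * rz ^+ 2
    - 2 * Dxy * Dyz * Dzx = rx ^+ 2 * ry ^+ 2 * rz ^+ 2.
  apply: (@mulfI _ (rx ^+ 2 * g ^+ 4)); first by rewrite mulf_neq0 ?expf_neq0.
  have : (W1 * W1) * (W3 * W3) = (W1 * W3) * (W1 * W3) by ring.
  rewrite e11 e33 e13 => e; apply/eqP; rewrite -subr_eq0; apply/eqP.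
  set T := g ^+ 2 * (Dzx * Dxy - rx ^+ 2 * Dyz) in e.
  by rewrite -[RHS](subrr (T * T)) -[in X in _ = _ - X]e /T; ring.
transitivity (((Dxy * Dyz - (W1 * W2) / g ^+ 2) * Dzx
    - ((W1 * W3) / g ^+ 2 * Dyz + Dxy * ((W2 * W3) / g ^+ 2)))
    / (rx ^+ 2 * ry ^+ 2 * rz ^+ 2)).
  by field; rewrite g0 x0 y0 z0.
have T0 : rx ^+ 2 * ry ^+ 2 * rz ^+ 2 != 0 by rewrite !mulf_neq0 ?expf_neq0.
rewrite e12 e13 e23; apply: (canLR (mulfK T0)); rewrite mul1r -K.
by field; rewrite ?g0.
Qed.

Lemma uniq5_last a b c e f : uniq [:: a; b; c; e; f] -> e != f.
Proof.
by rewrite /= !inE !negb_or -!andbA => /and5P[_ _ _ _ /and5P[_ _ _ _ /and3P[_ ]]].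
Qed.

(** In the plane normal to the triangle the signed angles are rotations from e to f, f to d and d to
    e, which close up. Algebraically, the cosine of their sum is 1. *)
Lemma deficit_sqlengths P a b c d e f : nondeg P a b c d e f ->
  exists m : int, deficit P a b c d e f (sqlengths P) = m%:~R * (2 * pi).
Proof.
case=> /uniq_simplices [U1 U2 U3] W1 W2 W3; apply: cos_eq1.
have [c1 s1] := trig_signed_angle U1 W1.
have [c2 s2] := trig_signed_angle U2 W2.
have [c3 s3] := trig_signed_angle U3 W3.
have G0 := gram2_gt0 W1.
have [E0 F0 _] := perp_dot_gt0 W1; have [D0 _ _] := perp_dot_gt0 W3.
rewrite /deficit cosN !cosD sinD c1 c2 c3 s1 s2 s3; move: W1 W2 W3 {c1 c2 c3 s1 s2 s3}.
rewrite /vol_form; set p := P a.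
move: (P b - p) (P c - p) (P d - p) (P e - p) (P f - p) G0 E0 F0 D0.
(* The vertices d, e, f become [z], [x], [y], matching the cyclic order of [cos_sum_eq1]. *)
move=> u v z x y G0 E0 F0 D0 W1 W2 W3.
have Gn : gram2 u v != 0 by rewrite gt_eqF.
have gE := sqr_sqrtr (ltW G0); have xE := sqr_sqrtr (ltW E0).
have yE := sqr_sqrtr (ltW F0); have zE := sqr_sqrtr (ltW D0).
apply: cos_sum_eq1; rewrite ?gt_eqF ?sqrtr_gt0 // ?gE ?xE ?yE ?zE.
- by rewrite (det_rows4_mul x y y z Gn) (perp_dotC _ _ z x).
- by rewrite (det_rows4_mul x y z x Gn) (perp_dotC _ _ z x) (perp_dotC _ _ y x).
- by rewrite (det_rows4_mul y z z x Gn) (perp_dotC _ _ y x).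
- by rewrite (det_rows4_mul x y x y Gn) (perp_dotC _ _ y x).
- by rewrite (det_rows4_mul z x z x Gn) (perp_dotC _ _ z x).
Qed.
End DeficitValue.

(** * Differentials of the deficit angles, and their vanishing along motions in R^4 *)

Section DeficitDifferential.
Variable R : realType.
Implicit Types (P Q : 'I_6 -> 'rV[R]_4) (a b c d e f x y : 'I_6).

Lemma is_diff_signed_angle P a b c x y D :
  uniq [:: a; b; c; x; y] -> vol_form (P a) (P b) (P c) (P x) (P y) != 0 ->
  is_diff (sqlengths P) (len_angle a b c x y) D ->
  is_diff (sqlengths P) (signed_angle P (simplex a b c x y))
    (Num.sg (vol_form (P a) (P b) (P c) (P x) (P y)) *: D).
Proof.
move=> U W0 dA; set W := vol_form _ _ _ _ _ in W0 *.
have N : \forall l \near sqlengths P,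
    (Num.sg W *: len_angle a b c x y) l = signed_angle P (simplex a b c x y) l.
  apply: filterS (near_inner_angle W0 U) => l e.
  by rewrite /signed_angle sgr_vol e.
have [dS dE] := is_diffZ (Num.sg W) dA.
have [dS' dE'] := near_eq_differentiable N dS.
by split; [exact: dS'|exact: etrans dE' dE].
Qed.

Lemma is_diff_deficit P a b c d e f D1 D2 D3 : nondeg P a b c d e f ->
  is_diff (sqlengths P) (len_angle a b c e f) D1 ->
  is_diff (sqlengths P) (len_angle a b c f d) D2 ->
  is_diff (sqlengths P) (len_angle a b c d e) D3 ->
  is_diff (sqlengths P) (deficit P a b c d e f)
    (- (Num.sg (vol_form (P a) (P b) (P c) (P e) (P f)) *: D1
        + Num.sg (vol_form (P a) (P b) (P c) (P f) (P d)) *: D2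
        + Num.sg (vol_form (P a) (P b) (P c) (P d) (P e)) *: D3)).
Proof.
case=> /uniq_simplices [U1 U2 U3] W1 W2 W3 d1 d2 d3.
have i1 := is_diff_signed_angle U1 W1 d1.
have i2 := is_diff_signed_angle U2 W2 d2.
have i3 := is_diff_signed_angle U3 W3 d3.
exact: (is_diffN (is_diffD (is_diffD i1 i2) i3)).
Qed.

Lemma diff_deficitE P a b c d e f D1 D2 D3 h : nondeg P a b c d e f ->
  is_diff (sqlengths P) (len_angle a b c e f) D1 ->
  is_diff (sqlengths P) (len_angle a b c f d) D2 ->
  is_diff (sqlengths P) (len_angle a b c d e) D3 ->
  'd (deficit P a b c d e f) (sqlengths P) h =
  - (Num.sg (vol_form (P a) (P b) (P c) (P e) (P f)) * D1 h
     + Num.sg (vol_form (P a) (P b) (P c) (P f) (P d)) * D2 h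
     + Num.sg (vol_form (P a) (P b) (P c) (P d) (P e)) * D3 h).
Proof. by move=> N d1 d2 d3; have [_ ->] := is_diff_deficit N d1 d2 d3. Qed.

Lemma is_diff_len_angle P a b c x y :
  vol_form (P a) (P b) (P c) (P x) (P y) != 0 ->
  is_diff (sqlengths P) (len_angle a b c x y) ('d (len_angle a b c x y) (sqlengths P)).
Proof. by move=> W0; split; first exact: differentiable_len_angle (nondeg_len_sqlengths W0). Qed.

Lemma differentiable_deficit P a b c d e f : nondeg P a b c d e f ->
  differentiable (deficit P a b c d e f) (sqlengths P).
Proof.
move=> N; case: (N) => _ W1 W2 W3.
by have [] := is_diff_deficit N (is_diff_len_angle W1) (is_diff_len_angle W2)
  (is_diff_len_angle W3).
Qed.

(** The determinant is a polynomial in [t], hence continuous, and keeps its sign near a point where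
    it is nonzero. *)
Lemma near_sg_det n (A B : 'M[R]_n) : \det A != 0 ->
  \forall t \near (0 : R), Num.sg (\det (t *: B + A)) = Num.sg (\det A).
Proof.
move=> A0.
pose p : {poly R} := \det ('X *: map_mx polyC B + map_mx polyC A).
have pE t : p.[t] = \det (t *: B + A).
  rewrite -[p.[t]]/(horner_eval t p) -det_map_mx; congr (\det _).
  apply/matrixP => i j; rewrite !mxE.
  by rewrite rmorphD rmorphM /= /horner_eval hornerX !hornerC.
have pc : {for 0, continuous (horner p)}.
  by apply/differentiable_continuous/derivable1_diffP/derivable_horner.
have p0 : p.[0] = \det A by rewrite pE scale0r add0r.
have e0 : 0 < `|\det A| by rewrite normr_gt0.
have /cvgr_distC_lt/(_ _ e0) := pc.
apply: filterS => t; rewrite p0 pE => H.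
case: (ltgtP (\det A) 0) A0 => // s _; move: H.
  by rewrite (ltr0_norm s) (ltr0_sg s) ltr_norml => /andP[_ H]; rewrite ltr0_sg //; lra.
by rewrite (gtr0_norm s) (gtr0_sg s) ltr_norml => /andP[H _]; rewrite gtr0_sg //; lra.
Qed.

Lemma near_sg_vol_form P Q a b c x y : vol_form (P a) (P b) (P c) (P x) (P y) != 0 ->
  \forall t \near (0 : R), let P' := fun i => t *: Q i + P i in
    Num.sg (vol_form (P' a) (P' b) (P' c) (P' x) (P' y))
    = Num.sg (vol_form (P a) (P b) (P c) (P x) (P y)).
Proof.
rewrite {1}/vol_form => /(near_sg_det (rows4 (Q b - Q a) (Q c - Q a) (Q x - Q a) (Q y - Q a))).
apply: filterS => t; rewrite -/(vol_form _ _ _ _ _) /= => <-; congr (Num.sg (\det _)).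
apply/matrixP => i j; rewrite !mxE.
by case: i => [[|[|[|[|//]]]] ?]; rewrite !(tnth_nth 0) /= !mxE; ring.
Qed.

(** First-order variation of the squared lengths when the points [P] move with velocities [Q]. *)
Definition sqlengths_tangent P Q : 'rV[R]_15 :=
  \row_(k < 15) (2 * dot (P (tnth edges k).1 - P (tnth edges k).2)
                         (Q (tnth edges k).1 - Q (tnth edges k).2)).

Lemma sqlengths_line P Q t :
  sqlengths (fun i => t *: Q i + P i) =
  (t * t) *: sqlengths Q + t *: sqlengths_tangent P Q + sqlengths P.
Proof.
apply/rowP => k; rewrite !mxE /sqdist; case: (tnth edges k) => i j /=.
rewrite opprD addrACA -scalerBr; move: (Q i - Q j) (P i - P j) => u v.
by rewrite !dot_linE (dotC v u); ring.
Qed.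

Lemma signed_angle_sg P P' s l :
  Num.sg (vol (P' \o s)) = Num.sg (vol (P \o s)) ->
  signed_angle P' s l = signed_angle P s l.
Proof. by rewrite /signed_angle => ->. Qed.

(** Along the motion [t *: Q + P] the deficit is continuous in [t] with values in the multiples of 2
    pi, hence locally constant; the chain rule concludes. *)
Lemma diff_deficit_tangent P Q a b c d e f : nondeg P a b c d e f ->
  'd (deficit P a b c d e f) (sqlengths P) (sqlengths_tangent P Q) = 0.
Proof.
move=> N; have dw := differentiable_deficit N.
case: (N) => U W1 W2 W3.
pose g (t : R) := sqlengths (fun i => t *: Q i + P i).
have gE : g = (fun t => (t * t) *: sqlengths Q) + (fun t => t *: sqlengths_tangent P Q)
    + cst (sqlengths P) by apply/funext => t; rewrite /g sqlengths_line.
have g0 : g 0 = sqlengths P by rewrite gE !fctE mul0r !scale0r !add0r.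
have dg : is_diff 0 g (fun t => t *: sqlengths_tangent P Q).
  have kd : is_diff (0 : R) (fun t : R => t * t) 0.
    have := is_diffM (is_diff_id (0 : R)) (is_diff_id (0 : R)).
    by rewrite !scale0r addr0.
  have [k1 k2] := kd.
  have qd : is_diff (0 : R) (fun t : R => (t * t) *: sqlengths Q) 0.
    split; first exact: differentiableZl k1.
    by rewrite (diffZl _ k1) k2; apply/funext => t; rewrite scale0r.
  have := is_diffD (is_diffD qd (is_diff_scalel (0 : R) (sqlengths_tangent P Q)))
    (is_diff_cst (sqlengths P) (0 : R)).
  by rewrite add0r addr0 gE.
pose F := deficit P a b c d e f \o g.
have dF : differentiable F 0.
  apply: differentiable_comp; first exact: ex_diff.
  by rewrite g0.
have Fc : F @ 0 --> F 0 by exact: differentiable_continuous dF.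
have Fint : \forall t \near (0:R), exists m : int, F t = m%:~R * (2 * pi).
  apply: filterS3 (near_sg_vol_form Q W1) (near_sg_vol_form Q W2)
    (near_sg_vol_form Q W3) => t; pose P' i := t *: Q i + P i.
  rewrite -!/(P' _) => s1 s2 s3.
  (* [deficit P] keeps the signs of [P], while [deficit_sqlengths] at the moved points uses those of
     [P']; for small [t] they agree. *)
  have N' : nondeg P' a b c d e f.
    by split; rewrite // -sgr_eq0 ?(s1, s2, s3) sgr_eq0.
  have [m mE] := deficit_sqlengths N'; exists m; rewrite -mE /F /deficit /=.
  by congr (- (_ + _ + _)); apply: signed_angle_sg; rewrite !sgr_vol.
have pi0 : 0 < 2 * (pi : R) by rewrite mulr_gt0 // pi_gt0.
have [m0 F0] := nbhs_singleton Fint.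
(* Two multiples of 2 pi at distance less than 2 pi coincide. *)
have Fcst : \forall t \near (0:R), cst (F 0) t = F t.
  have /cvgr_dist_lt/(_ _ pi0) := Fc.
  apply: filterS2 Fint => t [m Ft]; rewrite F0 Ft -mulrBl normrM (gtr0_norm pi0).
  rewrite gtr_pMl // -intrB -intr_norm ltrz1 => H.
  suff -> : m = m0 by [].
  by apply/esym/eqP; rewrite -subr_eq0 -normr_eq0; lia.
have [_ dF0] := near_eq_differentiable Fcst (differentiable_cst _ _).
have : 'd F 0 1 = 0 by rewrite dF0 diff_cst.
rewrite /F diff_comp; [|exact: ex_diff|by rewrite g0].
by rewrite /= diff_val g0 scale1r.
Qed.

End DeficitDifferential.

(** * Variation of one edge *)

Section EdgeDerivative.
Variable R : realType.
Implicit Types (P : 'I_6 -> 'rV[R]_4) (l : 'rV[R]_15) (a b c d e f x y i j : 'I_6).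

Lemma len_edge l e f (t : R) i j : e != f ->
  len (t *: delta_mx 0 (edge_index e f) + l) i j =
  len l i j + t *+ (((i == e) && (j == f)) || ((i == f) && (j == e))).
Proof.
move=> ef; rewrite !lenE; case: (eqVneq i j) => [->|ij].
  by case: (eqVneq j e) => [->|_]; rewrite ?(negPf ef) ?andbF addr0.
rewrite !mxE eqxx /= -[t *+ _]mulr_natr addrC; congr (_ + _ * _%:R); congr nat_of_bool.
apply/eqP/orP => [E|[/andP[/eqP -> /eqP ->]|/andP[/eqP -> /eqP ->]] //];
  last exact: edge_indexC.
case: (edge_indexP ij) (edge_indexP ef); rewrite E => -> [] [-> ->];
  rewrite !eqxx; by [left|right].
Qed.

Lemma len_dot_edge l e f (t : R) a i j : e != f ->
  ~~ ((e \in [:: a; i; j]) && (f \in [:: a; i; j])) ->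
  len_dot (t *: delta_mx 0 (edge_index e f) + l) a i j = len_dot l a i j.
Proof.
move=> ef; rewrite /len_dot !len_edge // !inE !(eq_sym e) !(eq_sym f).
by do 6?case: eqP => _ //=; rewrite ?addr0 // => _.
Qed.

Lemma len_perp_dot_edge l e f (t : R) a b c x y : e != f ->
  ~~ ((e \in [:: a; b; c; x; y]) && (f \in [:: a; b; c; x; y])) ->
  len_perp_dot (t *: delta_mx 0 (edge_index e f) + l) a b c x y =
  len_perp_dot l a b c x y.
Proof.
move=> ef N.
have N' u v : u \in [:: a; b; c; x; y] -> v \in [:: a; b; c; x; y] ->
    ~~ ((e \in [:: a; u; v]) && (f \in [:: a; u; v])).
  move=> Hu Hv; apply: contra N => /andP[He Hf].
  have sub : {subset [:: a; u; v] <= [:: a; b; c; x; y]}.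
    by move=> z; rewrite in_cons in_cons mem_seq1 => /or3P[]/eqP-> //; exact: mem_head.
  by rewrite !sub.
by rewrite /len_perp_dot !len_dot_edge // N' // !inE eqxx ?orbT.
Qed.

Lemma is_derive_cst_line (V : normedModType R) (F : R -> V) :
  (forall t, F t = F 0) -> is_derive (0 : R) 1 F 0.
Proof. by move=> /funext ->; exact: is_derive_cst. Qed.

Lemma diff_len_angle_notin P e f a b c x y : e != f ->
  vol_form (P a) (P b) (P c) (P x) (P y) != 0 ->
  ~~ ((e \in [:: a; b; c; x; y]) && (f \in [:: a; b; c; x; y])) ->
  'd (len_angle a b c x y) (sqlengths P) (delta_mx 0 (edge_index e f)) = 0.
Proof.
move=> ef W0 N; apply: derive_line.
  exact: differentiable_len_angle (nondeg_len_sqlengths W0).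
apply: is_derive_cst_line => t.
have N' u v : u \in [:: x; y] -> v \in [:: x; y] ->
    ~~ ((e \in [:: a; b; c; u; v]) && (f \in [:: a; b; c; u; v])).
  move=> Hu Hv; apply: contra N => /andP[He Hf].
  have sub : {subset [:: a; b; c; u; v] <= [:: a; b; c; x; y]}.
    move=> z; rewrite 4!in_cons mem_seq1 => /or4P[/eqP->|/eqP->|/eqP->|/orP[]/eqP->];
      rewrite ?inE ?eqxx ?orbT //; [move: Hu|move: Hv];
      by rewrite !inE => /orP[]/eqP ->; rewrite eqxx ?orbT.
  by rewrite !sub.
by rewrite /len_angle !len_perp_dot_edge // N' // !inE eqxx ?orbT.
Qed.

(** The edge ef enters only through [len_dot l a e f], with factor -1/2, and a Schur complement has
    slope 1 in that entry. *)
Lemma len_perp_dot_edge_in l (t : R) a b c e f : uniq [:: a; b; c; e; f] ->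
  len_perp_dot (t *: delta_mx 0 (edge_index e f) + l) a b c e f =
  len_perp_dot l a b c e f - t / 2.
Proof.
rewrite /= !inE !negb_or -!andbA.
move=> /and5P[_ _ ae af /and5P[_ be bf ce /and3P[cf ef _]]].
have E : len_dot (t *: delta_mx 0 (edge_index e f) + l) a e f = len_dot l a e f - t / 2.
  rewrite /len_dot !len_edge // !eqxx (negPf ae) (negPf af) /= !addr0 !mulr1n.
  by field.
have e' : [/\ e == a = false, e == b = false & e == c = false].
  by rewrite !(eq_sym e) (negPf ae) (negPf be) (negPf ce).
have f' : [/\ f == a = false, f == b = false & f == c = false].
  by rewrite !(eq_sym f) (negPf af) (negPf bf) (negPf cf).
case: e' f' => e1 e2 e3 [f1 f2 f3].
rewrite /len_perp_dot E !len_dot_edge ?inE ?(e1, e2, e3, f1, f2, f3, andbF)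
  ?(eq_sym f e) ?(negPf ef) //.
  by rewrite /schur addrAC.
  by rewrite /= andbF.
by rewrite /= andbF.
Qed.

(** Along this edge the angle is [acos ((p - t / 2) / s)], with derivative [1 / (2 s sin)] at 0. By
    [sin_dihedral], [s sin] is the absolute volume form over the square root of [gram2], which is
    twice the area. *)
Lemma diff_len_angle_edge P a b c e f : uniq [:: a; b; c; e; f] ->
  vol_form (P a) (P b) (P c) (P e) (P f) != 0 ->
  'd (len_angle a b c e f) (sqlengths P) (delta_mx 0 (edge_index e f)) =
  area (P a) (P b) (P c) / `|vol_form (P a) (P b) (P c) (P e) (P f)|.
Proof.
move=> U W0; apply: derive_line.
  exact: differentiable_len_angle (nondeg_len_sqlengths W0).
have [G0 X0 Y0 D0] := nondeg_len_sqlengths W0.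
have H := cos_quotient_lt1 X0 Y0 D0.
have ef := uniq5_last U.
have [na nb] : e \notin [:: a; b; c] /\ f \notin [:: a; b; c].
  move: U; rewrite (cat_uniq [:: a; b; c] [:: e; f]) => /and3P[_ + _].
  by rewrite /= orbF negb_or => /andP.
set p := len_perp_dot _ _ _ _ e f in H D0.
set q := len_perp_dot _ _ _ _ e e in H D0 X0.
set r := len_perp_dot _ _ _ _ f f in H D0 Y0.
set s := Num.sqrt q * Num.sqrt r in H.
have -> : (fun t : R => len_angle a b c e f (t *: delta_mx 0 (edge_index e f) + sqlengths P))
    = acos \o (fun t => (p - t / 2) / s).
  have n1 : e \in [:: a; b; c; f; f] = false.
    by move: na; rewrite !inE orbb !orbA (negPf ef) orbF => /negPf ->.
  have n2 : f \in [:: a; b; c; e; e] = false.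
    by move: nb; rewrite !inE orbb !orbA (eq_sym f e) (negPf ef) orbF => /negPf ->.
  by apply/funext => t; rewrite /len_angle len_perp_dot_edge_in //
    !len_perp_dot_edge ?n1 ?n2 ?andbF.
have dl : is_derive (0 : R) 1 (fun t : R => (p - t / 2) / s) (- (2 * s)^-1).
  have s0 : s != 0 by rewrite mulf_neq0 // gt_eqF // sqrtr_gt0.
  have -> : (fun t : R => (p - t / 2) / s) = cst (p / s) + (- (2 * s)^-1) *: id.
    by apply/funext => t; rewrite !fctE /GRing.scale /=; field.
  have := is_deriveD (is_derive_cst (p / s) (0 : R) 1)
    (is_deriveZ (- (2 * s)^-1) (is_derive_id (0 : R) (1 : R))).
  by rewrite add0r [_ *: 1]mulr1.
have H0 : -1 < (p - 0 / 2) / s < 1 by rewrite mul0r subr0.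
have := @is_derive1_comp R acos (fun t => (p - t / 2) / s) 0 _ _ (is_derive1_acos H0) dl.
rewrite mul0r subr0 => /is_derive_eq; apply.
rewrite /s /p /q /r !len_perp_dot_sqlengths (sin_dihedral W0) -!len_perp_dot_sqlengths.
rewrite -/p -/q -/r -/s -/(vol_form _ _ _ _ _) /area -/(gram2 _ _).
have s0 : s != 0 by rewrite mulf_neq0 // gt_eqF // sqrtr_gt0.
have g0 : Num.sqrt (gram2 (P b - P a) (P c - P a)) != 0.
  by rewrite gt_eqF // sqrtr_gt0 (gram2_gt0 W0).
have n0 : `|vol_form (P a) (P b) (P c) (P e) (P f)| != 0 by rewrite normr_eq0.
by rewrite /GRing.scale /=; field; rewrite n0 g0 s0.
Qed.

Lemma is_diff_len_angle_at P a b c x y h k :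
  vol_form (P a) (P b) (P c) (P x) (P y) != 0 ->
  'd (len_angle a b c x y) (sqlengths P) h = k ->
  exists2 D, is_diff (sqlengths P) (len_angle a b c x y) D & D h = k.
Proof.
move=> W0 hk; exists ('d (len_angle a b c x y) (sqlengths P)) => //.
exact: is_diff_len_angle.
Qed.

(** Only the simplex abcef contains both e and f; its sign turns the absolute value of the volume
    form into the volume form itself. *)
Lemma diff_deficit_edge P a b c d e f : nondeg P a b c d e f ->
  'd (deficit P a b c d e f) (sqlengths P) (delta_mx 0 (edge_index e f)) =
  - area (P a) (P b) (P c) / vol_form (P a) (P b) (P c) (P e) (P f).
Proof.
move=> N; case: (N) => U W1 W2 W3.
have [U1 U2 U3] := uniq_simplices U.
have ef := uniq5_last U1.
have Ne : ~~ ((e \in [:: a; b; c; f; d]) && (f \in [:: a; b; c; f; d])).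
  apply/negP => /andP[]; rewrite !inE => H _; move: H U.
  by do ?case/orP; move=> /eqP ->; rewrite /= !inE !eqxx ?orbT ?andbF.
have Nf : ~~ ((e \in [:: a; b; c; d; e]) && (f \in [:: a; b; c; d; e])).
  apply/negP => /andP[_]; rewrite !inE => H; move: H U.
  by do ?case/orP; move=> /eqP ->; rewrite /= !inE !eqxx ?orbT ?andbF.
have v1 := diff_len_angle_edge U1 W1.
have v2 := diff_len_angle_notin ef W2 Ne; have v3 := diff_len_angle_notin ef W3 Nf.
have [D1 d1 {}v1] := is_diff_len_angle_at W1 v1.
have [D2 d2 {}v2] := is_diff_len_angle_at W2 v2.
have [D3 d3 {}v3] := is_diff_len_angle_at W3 v3.
rewrite (diff_deficitE _ N d1 d2 d3) v1 v2 v3.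
rewrite !mulr0 !addr0 mulNr; congr (- _).
set W := vol_form _ _ _ _ _ in W1 *.
have -> : `|W| = Num.sg W * W by rewrite normrEsg.
have s0 : Num.sg W != 0 by rewrite sgr_eq0.
by field; rewrite W1 s0.
Qed.

End EdgeDerivative.

(** * Oriented volumes under permutations of the vertices *)

Section OrientedVolume.
Variable R : realType.
Implicit Types (Q : 'I_5 -> 'rV[R]_4) (P : 'I_6 -> 'rV[R]_4).

(** Homogeneous coordinates: permuting vertices permutes rows, and the left kernel consists of the
    affine dependences. *)
Definition affine_mx n (Q : 'I_n -> 'rV[R]_4) : 'M[R]_(n, 1 + 4) :=
  row_mx (const_mx 1) (\matrix_(i < n) Q i).

Lemma det_affine_mx Q : \det (affine_mx Q) = 4`!%:R * vol Q.
Proof.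
rewrite /vol mulrC divfK ?fact4_neq0 //; set D := \matrix_i _.
pose L : 'M[R]_(1 + 4) := block_mx 1%:M 0 (const_mx 1) 1%:M.
(* The unipotent [L] undoes the subtraction of the first row from the others. *)
have -> : affine_mx Q = L *m block_mx 1%:M (Q ord0) 0 D.
  rewrite mulmx_block !(mul1mx, mul0mx, mulmx0, mulmx1, addr0, add0r).
  apply/matrixP => i j; rewrite -[i](@fintype.splitK 1 4) -[j](@fintype.splitK 1 4).
  case: (@fintype.split 1 4 i) => {}i; case: (@fintype.split 1 4 j) => {}j /=.
  - by apply: etrans _ (esym (block_mxEul _ _ _ _ _ _)); rewrite row_mxEl !mxE !ord1.
  - apply: etrans _ (esym (block_mxEur _ _ _ _ _ _)).
    rewrite row_mxEr !mxE ord1; congr (Q _ _ _); exact/val_inj.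
  - by apply: etrans _ (esym (block_mxEdl _ _ _ _ _ _)); rewrite row_mxEl !mxE.
  - apply: etrans _ (esym (block_mxEdr _ _ _ _ _ _)).
    rewrite row_mxEr !mxE big_ord1 !mxE mul1r addrC subrK.
    by congr (Q _ _ _); apply/val_inj.
rewrite det_mulmx; have -> : \det L = 1.
  by apply: etrans (det_lblock _ _ _) _; rewrite !det1 mulr1.
rewrite mul1r; have E := det_ublock (1%:M : 'M[R]_1) (Q ord0) D.
rewrite det1 mul1r in E. refine (eq_trans _ E).
reflexivity.
Qed.

Lemma vol_tperm Q i j : i != j -> vol (Q \o tperm i j) = - vol Q.
Proof.
move=> ij; apply: (mulfI (fact4_neq0 R)); rewrite mulrN -!det_affine_mx.
have -> : affine_mx (Q \o tperm i j) = perm_mx (tperm i j) *m affine_mx Q.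
  rewrite -row_permE; apply/matrixP => k l; rewrite !mxE.
  by case: (@fintype.split 1 4 l) => m; rewrite !mxE.
by rewrite det_mulmx det_perm odd_tperm ij expr1 mulN1r.
Qed.

Let o k : 'I_5 := inord k.

Lemma vol_rot2 Q :
  vol (fun i => Q (tnth [tuple o 2; o 3; o 4; o 0; o 1] i)) = vol Q.
Proof.
(* The shift by two is a 5-cycle, written as four transpositions. *)
have -> : (fun i => Q (tnth [tuple o 2; o 3; o 4; o 0; o 1] i)) =
    Q \o tperm (o 0) (o 2) \o tperm (o 2) (o 4) \o tperm (o 4) (o 1) \o tperm (o 1) (o 3).
  apply/funext => i /=; congr Q.
  have -> : i = o i by rewrite /o inord_val.
  by case: i => [[|[|[|[|[|//]]]]] ?]; rewrite (tnth_nth ord0) /=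
    !permE /= -!val_eqE /= !inordK //= ?inordK //= -!val_eqE /= !inordK.
by rewrite !vol_tperm ?opprK // -val_eqE /= !inordK.
Qed.

Lemma vol_rot2_swap Q :
  vol (fun i => Q (tnth [tuple o 2; o 3; o 4; o 1; o 0] i)) = - vol Q.
Proof.
have -> : (fun i => Q (tnth [tuple o 2; o 3; o 4; o 1; o 0] i)) =
    Q \o tperm (o 0) (o 2) \o tperm (o 2) (o 4) \o tperm (o 1) (o 3).
  apply/funext => i /=; congr Q.
  have -> : i = o i by rewrite /o inord_val.
  by case: i => [[|[|[|[|[|//]]]]] ?]; rewrite (tnth_nth ord0) /=
    !permE /= -!val_eqE /= !inordK //= ?inordK //= -!val_eqE /= !inordK.
by rewrite !vol_tperm ?opprK // -val_eqE /= !inordK.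
Qed.

Lemma vol_ABCEF P : vol (P \o simplex vA vB vC vE vF) = V P vD.
Proof.
congr vol; apply/funext => i /=; congr P.
by case: i => [[|[|[|[|[|//]]]]] ?]; apply/val_inj.
Qed.

Lemma vol_ABCDE P : vol (P \o simplex vA vB vC vD vE) = V P vF.
Proof.
congr vol; apply/funext => i /=; congr P.
by case: i => [[|[|[|[|[|//]]]]] ?]; apply/val_inj.
Qed.

Lemma vol_ABCFD P : vol (P \o simplex vA vB vC vF vD) = - V P vE.
Proof.
rewrite /V -(@vol_tperm _ (o 3) (o 4)); last by rewrite -val_eqE /= !inordK.
congr vol; apply/funext => i /=; congr P; apply/val_inj.
have -> : i = o i by rewrite /o inord_val.
by case: i => [[|[|[|[|[|//]]]]] ?]; rewrite /simplex (tnth_nth vA) /=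
    !permE /= -!val_eqE /= !inordK //= ?inordK.
Qed.

Lemma vol_DEFBC P : vol (P \o simplex vD vE vF vB vC) = V P vA.
Proof.
rewrite /V -[RHS]vol_rot2; congr vol; apply/funext => i /=; congr P; apply/val_inj.
by case: i => [[|[|[|[|[|//]]]]] ?]; rewrite /simplex !(tnth_nth vA) (tnth_nth ord0) /= inordK.
Qed.

Lemma vol_DEFCA P : vol (P \o simplex vD vE vF vC vA) = - V P vB.
Proof.
rewrite /V -[RHS]vol_rot2_swap; congr vol; apply/funext => i /=; congr P; apply/val_inj.
by case: i => [[|[|[|[|[|//]]]]] ?]; rewrite /simplex !(tnth_nth vA) (tnth_nth ord0) /= inordK.
Qed.

Lemma vol_DEFAB P : vol (P \o simplex vD vE vF vA vB) = V P vC.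
Proof.
rewrite /V -[RHS]vol_rot2; congr vol; apply/funext => i /=; congr P; apply/val_inj.
by case: i => [[|[|[|[|[|//]]]]] ?]; rewrite /simplex !(tnth_nth vA) (tnth_nth ord0) /= inordK.
Qed.

End OrientedVolume.

(** * Equilibrium stresses *)

Section Stress.
Variable R : realType.
Implicit Types (P Q : 'I_6 -> 'rV[R]_4) (i j k : 'I_6).

Lemma sum_I6 (A : nmodType) (F : 'I_6 -> A) :
  \sum_(i < 6) F i = F vA + F vB + F vC + F vD + F vE + F vF.
Proof.
rewrite !big_ord_recl big_ord0 addr0 !addrA.
by do !congr (_ + _); congr F; apply/val_inj.
Qed.

Lemma sum_edges (G : 'I_6 -> 'I_6 -> R) :
  (forall i j, G i j = G j i) -> (forall i, G i i = 0) ->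
  \sum_i \sum_j G i j = 2 * \sum_(k < 15) G (tnth edges k).1 (tnth edges k).2.
Proof.
move=> Gs G0; rewrite -(big_tuple _ _ edges xpredT (fun e => G e.1 e.2)).
rewrite !big_cons big_nil /= !sum_I6 !G0.
rewrite (Gs vB vA) !(Gs vC vA) !(Gs vC vB) !(Gs vD vA) !(Gs vD vB) !(Gs vD vC)
  !(Gs vE vA) !(Gs vE vB) !(Gs vE vC) !(Gs vE vD) !(Gs vF vA) !(Gs vF vB)
  !(Gs vF vC) !(Gs vF vD) !(Gs vF vE).
by ring.
Qed.

(** A linear form is a weight on each edge, and ordered pairs count each edge twice. On the diagonal
    [edge_index i i] is a meaningless default, harmless because [len] vanishes there. *)
Lemma sum_len (phi : {linear 'rV[R]_15 -> R}) (h : 'rV[R]_15) :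
  \sum_i \sum_j len h i j * phi (delta_mx 0 (edge_index i j)) = 2 * phi h.
Proof.
rewrite sum_edges.
- congr (2 * _); rewrite [in RHS](row_sum_delta h) linear_sum; apply: eq_bigr => k _.
  by rewrite len_edges edge_index_edges linearZ.
- by move=> i j; rewrite lenC edge_indexC.
- by move=> i; rewrite lenxx mul0r.
Qed.

Lemma len_tangent P Q i j :
  len (sqlengths_tangent P Q) i j = 2 * dot (P i - P j) (Q i - Q j).
Proof.
rewrite lenE; case: eqVneq => [->|ij]; first by rewrite subrr /dot mul0mx mxE mulr0.
rewrite mxE; case: (edge_indexP ij) => -> //=.
by rewrite -[P j - _]opprB -[Q j - _]opprB dotNl dotNr opprK.
Qed.

Lemma dot_eq0 (u : 'rV[R]_4) : dot u u = 0 -> u = 0.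
Proof.
rewrite dotE => /eqP; rewrite psumr_eq0; last by move=> k _; rewrite -expr2 sqr_ge0.
move=> /allP u0; apply/rowP => k; rewrite mxE; apply/eqP.
by have := u0 k (mem_index_enum _); rewrite /= mulf_eq0 orbb.
Qed.

Lemma dot_suml n (F : 'I_n -> 'rV[R]_4) v : dot (\sum_i F i) v = \sum_i dot (F i) v.
Proof. by rewrite /dot mulmx_suml summxE. Qed.

(** Let the points move with velocities equal to the resultants [r i] themselves: [phi] of this
    variation is twice the sum of the squared norms of the [r i], so all of them vanish. *)
Lemma stress_equilibrium P (phi : {linear 'rV[R]_15 -> R}) :
  (forall Q, phi (sqlengths_tangent P Q) = 0) ->
  forall i, \sum_j phi (delta_mx 0 (edge_index i j)) *: (P i - P j) = 0.
Proof.
move=> phi0; pose s i j := phi (delta_mx 0 (edge_index i j)).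
have sC i j : s i j = s j i by rewrite /s edge_indexC.
pose r i := \sum_j s i j *: (P i - P j).
have rr : \sum_i dot (r i) (r i) = 0.
  have := sum_len phi (sqlengths_tangent P r); rewrite phi0 mulr0 => E.
  apply: (@mulfI _ 4); rewrite ?pnatr_eq0 // mulr0; apply: etrans _ E.
  have E1 : \sum_i dot (r i) (r i) = \sum_i \sum_j s i j * dot (P i - P j) (r i).
    apply: eq_bigr => i _; rewrite {1}/r dot_suml; apply: eq_bigr => j _.
    by rewrite dotZl.
  have E2 : \sum_i dot (r i) (r i) = \sum_i \sum_j - (s i j * dot (P i - P j) (r j)).
    rewrite E1 exchange_big; apply: eq_bigr => i _; apply: eq_bigr => j _.
    by rewrite sC -[P j - _]opprB dotNl mulrN.
  have -> : 4 * (\sum_i dot (r i) (r i)) =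
      2 * (\sum_i dot (r i) (r i) + \sum_i dot (r i) (r i)) by ring.
  rewrite {1}E1 E2 -big_split mulr_sumr; apply: eq_bigr => i _.
  rewrite -big_split mulr_sumr; apply: eq_bigr => j _.
  by rewrite len_tangent dotDr dotNr -/(s i j) /=; ring.
move=> i; apply: dot_eq0; apply/eqP; move/eqP: rr.
rewrite psumr_eq0; last by move=> k _; exact: dot_ge0.
by move/allP/(_ i (mem_index_enum _)).
Qed.

Lemma det_row'_affine_mx P i : \det (row' i (affine_mx P)) = 4`!%:R * V P i.
Proof.
rewrite /V -det_affine_mx; congr (\det _); apply/matrixP => j k; rewrite !mxE.
by case: (@fintype.split 1 4 k) => m; rewrite !mxE.
Qed.

Definition affine_dep P : 'rV[R]_6 := \row_j ((-1) ^+ j * V P j).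

(* Laplace expansion of a determinant with a repeated column. *)
Lemma affine_depP P : affine_dep P *m affine_mx P = 0.
Proof.
apply/rowP => k; rewrite [RHS]mxE; apply: (mulfI (fact4_neq0 R)); rewrite mulr0.
pose B : 'M[R]_(1 + (1 + 4)) := row_mx (col k (affine_mx P)) (affine_mx P).
have : \det B = 0.
  rewrite -det_tr; apply: (determinant_alternate (i1 := lshift (1 + 4) 0) (i2 := rshift 1 k)).
    by rewrite eq_lrshift.
  move=> j; rewrite ![B^T _ _]mxE.
  by apply: etrans (row_mxEl _ _ _ _) (etrans _ (esym (row_mxEr _ _ _ _))); rewrite mxE.
rewrite (expand_det_col _ (lshift (1 + 4) 0)); apply: etrans; rewrite mxE mulr_sumr.
apply: eq_bigr => j _.
have -> : B j (lshift (1 + 4) 0) = affine_mx P j k.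
  by apply: etrans (row_mxEl _ _ _ _) _; rewrite mxE.
rewrite /cofactor /= addn0.
have -> : row' j (col' (lshift (1 + 4) 0) B) = row' j (affine_mx P).
  apply/matrixP => u v; rewrite 2![LHS]mxE [RHS]mxE.
  apply: etrans _ (row_mxEr (col k (affine_mx P)) _ _ _).
  by congr (B _ _); apply/val_inj.
by rewrite det_row'_affine_mx mxE; ring.
Qed.

(** Without the point [j] the other five are affinely independent, so the dependences form a space
    of dimension at most one, detected by the coordinate [j]. *)
Lemma affine_dep_unique P (c : 'rV[R]_6) j : V P j != 0 ->
  c *m affine_mx P = 0 -> c 0 j = 0 -> c = 0.
Proof.
move=> Vj cN cj.
have U : row' j (affine_mx P) \in unitmx.
  by rewrite unitmxE unitfE det_row'_affine_mx mulf_neq0 ?fact4_neq0.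
have : col' j c *m row' j (affine_mx P) = 0.
  rewrite -cN; apply/rowP => k; rewrite !mxE (bigD1_ord j) //= cj mul0r add0r.
  by apply: eq_bigr => i _; rewrite !mxE.
move/(congr1 (mulmxr (invmx (row' j (affine_mx P))))); rewrite /= mulmxK // mul0mx => c0.
apply/rowP => i; rewrite mxE; case: (unliftP j i) => [i' ->|-> //].
by have := congr1 (fun A : 'rV_5 => A 0 i') c0; rewrite !mxE.
Qed.

(** Equilibrium at [i] makes the weights at [i] an affine dependence, hence proportional to [lam].
    By symmetry of the weights, [s i j / (lam i * lam j)] is the same for all edges. *)
Lemma stress_unique P (phi : {linear 'rV[R]_15 -> R}) e f (h : 'rV[R]_15) :
  (forall i, V P i != 0) -> (forall Q, phi (sqlengths_tangent P Q) = 0) -> e != f ->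
  let lam j := (-1) ^+ (j : nat) * V P j in
  phi h = phi (delta_mx 0 (edge_index e f)) / (lam e * lam f)
          * ((\sum_i \sum_j lam i * lam j * len h i j) / 2).
Proof.
move=> V0 phi0 ef lam; pose s i j := phi (delta_mx 0 (edge_index i j)).
have lam0 i : lam i != 0 by rewrite mulf_neq0 // expf_neq0 // oppr_eq0 oner_eq0.
have sC i j : s i j = s j i by rewrite /s edge_indexC.
have P1 i j k : j != i -> k != i -> s i j * lam k = s i k * lam j.
  move=> ji ki.
  (* The entry at [i] makes the coefficients sum to zero; equilibrium gives the other four
     columns. *)
  pose c : 'rV[R]_6 := \row_j (if j == i then - \sum_(j | j != i) s i j else s i j).
  have cN : c *m affine_mx P = 0.
    have cx (x : 'I_6 -> R) : \sum_j c 0 j * x j = \sum_(j | j != i) s i j * (x j - x i).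
      rewrite (bigD1 i) //= mxE eqxx mulNr mulr_suml addrC -sumrB.
      by apply: eq_bigr => j' /negPf ji'; rewrite mxE ji' mulrBr.
    rewrite /affine_mx mul_mx_row -[RHS]row_mx0; congr row_mx.
      apply/rowP => z; rewrite !mxE; under eq_bigr do rewrite [const_mx _ _ _]mxE.
      by rewrite cx big1 // => j' _; rewrite subrr mulr0.
    apply/rowP => z; rewrite !mxE; under eq_bigr do rewrite [(\matrix_i P i) _ _]mxE.
    rewrite (cx (fun j => P j 0 z)).
    have /rowP/(_ z) := stress_equilibrium phi0 i.
    rewrite (bigD1 i) //= subrr scaler0 add0r summxE mxE => E.
    apply: oppr_inj; rewrite oppr0; apply: etrans _ E; rewrite -sumrN.
    by apply: eq_bigr => j' _; rewrite !mxE -/(s i j'); ring.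
  (* This combination of two dependences is built to vanish at [j]; its entry at [k] gives the
     proportionality. *)
  have := @affine_dep_unique P (lam j *: c - c 0 j *: affine_dep P) j (V0 j).
  rewrite mulmxBl -!scalemxAl cN affine_depP !scaler0 subrr !mxE (negPf ji) => /(_ erefl).
  rewrite mulrC subrr => /(_ erefl) /rowP/(_ k).
  by rewrite !mxE (negPf ki) => /eqP; rewrite subr_eq0 mulrC => /eqP.
pose X i j := s i j / (lam i * lam j).
have XC i j : X i j = X j i by rewrite /X sC [lam i * _]mulrC.
have n i j : lam i * lam j != 0 by rewrite mulf_neq0.
have X1 i j k : j != i -> k != i -> X i j = X i k.
  move=> ji ki; rewrite /X; apply/eqP; rewrite (eqr_div _ _ (n i j) (n i k)).
  by rewrite mulrCA (P1 _ _ _ ji ki); apply/eqP; ring.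
(* Pass from ij to ef through edges sharing a vertex: ij, if, ef; when [i] is [f], the edges ij and
   ef already meet. *)
have X2 i j : i != j -> X i j = X e f.
  move=> ij; have [E|fi] := eqVneq i f.
    rewrite (XC e f); subst i; have jf : j != f by rewrite eq_sym.
    exact: (X1 f j e jf ef).
  have ji : j != i by rewrite eq_sym.
  have fi' : f != i by rewrite eq_sym.
  rewrite (X1 i j f ji fi') (XC i f) (XC e f); exact: (X1 f i e fi ef).
apply: (@mulfI _ 2); rewrite ?pnatr_eq0 // -sum_len [RHS]mulrCA (mulrC 2) divfK ?pnatr_eq0 //.
rewrite mulr_sumr; apply: eq_bigr => i _; rewrite mulr_sumr; apply: eq_bigr => j _.
have [->|ij] := eqVneq i j; first by rewrite lenxx mul0r !mulr0.
rewrite -/(s i j) -/(s e f) -/(X e f) -(X2 i j ij) /X; field.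
by rewrite !lam0.
Qed.

End Stress.

(** * Comparison of the two differentials *)

Lemma nondegABC (R : realType) (P : 'I_6 -> 'rV[R]_4) :
  (forall i, V P i != 0) -> nondeg P vA vB vC vD vE vF.
Proof.
move=> V0; split=> //; rewrite -vol_simplex_eq0.
- by rewrite vol_ABCEF.
- by rewrite vol_ABCFD oppr_eq0.
- by rewrite vol_ABCDE.
Qed.

Lemma nondegDEF (R : realType) (P : 'I_6 -> 'rV[R]_4) :
  (forall i, V P i != 0) -> nondeg P vD vE vF vA vB vC.
Proof.
move=> V0; split=> //; rewrite -vol_simplex_eq0.
- by rewrite vol_DEFBC.
- by rewrite vol_DEFCA oppr_eq0.
- by rewrite vol_DEFAB.
Qed.

(** The edge ef fixes the constant in [stress_unique], and the area cancels. The remaining double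
    sum does not involve the choice of the triangle. *)
Lemma diff_deficit_formula (R : realType) (P : 'I_6 -> 'rV[R]_4) a b c d e f
    (h : 'rV[R]_15) :
  (forall i, V P i != 0) -> nondeg P a b c d e f ->
  'd (deficit P a b c d e f) (sqlengths P) h / area (P a) (P b) (P c) =
  - (4`!%:R * vol (P \o simplex a b c e f)
     * ((-1) ^+ e * V P e) * ((-1) ^+ f * V P f))^-1
  * ((\sum_(i < 6) \sum_(j < 6)
        (-1) ^+ (i : nat) * V P i * ((-1) ^+ (j : nat) * V P j) * len h i j) / 2).
Proof.
move=> V0 N; case: (N) => U W1 _ _.
have ef : e != f.
  by have [/uniq5_last] := uniq_simplices U.
have S0 : area (P a) (P b) (P c) != 0.
  rewrite /area -/(gram2 _ _) mulf_neq0 ?invr_eq0 ?pnatr_eq0 // gt_eqF //.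
  by rewrite sqrtr_gt0 (gram2_gt0 W1).
have T Q := diff_deficit_tangent Q N.
rewrite (stress_unique h V0 T ef) (diff_deficit_edge N).
rewrite vol_simplex (mulrC 4`!%:R) divfK ?fact4_neq0 //.
have e0 := V0 e; have f0 := V0 f.
have s n : (-1) ^+ n != 0 :> R by rewrite expf_neq0 // oppr_eq0 oner_eq0.
have se := s e; have sf := s f.
field.
by rewrite W1 S0 e0 f0 se sf.
Qed.

Theorem mainTheorem2 (R : realType) (P : 'I_6 -> 'rV[R]_4)
    (nondegenerate : forall i : 'I_6, V P i != 0) :
  let l0 := sqlengths P in
  [/\ exists m : int, omegaABC P l0 = m%:~R * (2 * pi),
      exists n : int, omegaDEF P l0 = n%:~R * (2 * pi),
      differentiable (omegaABC P) l0,
      differentiable (omegaDEF P) l0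
    & forall h : 'rV[R]_15,
        V P vD * (- V P vE) * V P vF
          * ('d (omegaABC P) l0 h / area (P vA) (P vB) (P vC))
        = V P vA * (- V P vB) * V P vC
          * ('d (omegaDEF P) l0 h / area (P vD) (P vE) (P vF))].
Proof.
have NA := nondegABC nondegenerate; have ND := nondegDEF nondegenerate.
split.
- exact: (deficit_sqlengths NA).
- exact: (deficit_sqlengths ND).
- exact: (differentiable_deficit NA).
- exact: (differentiable_deficit ND).
move=> h.
rewrite (diff_deficit_formula h nondegenerate NA) (diff_deficit_formula h nondegenerate ND).
rewrite vol_ABCEF vol_DEFBC; move: (_ / 2) => L.
have V0 := nondegenerate.
(* The labels E, F and B, C have opposite parities within each pair, so each product of two
   coefficients has sign -1, matching the minus sign on [V P vE] or [V P vB]; both sides are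
   [- L / 24]. *)
rewrite /= !exprS expr0; field.
by rewrite !V0 fact4_neq0.
Qed.
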